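(* Let $\Bbbk$ be a field, let $G$ be a threshold graph, and let $Q=\Bbbk[V(G)]$ be the polynomial ring on the vertices of $G$. Then the minimal free resolution of $Q/I(G)$ over $Q$ admits the structure of a strictly commutative dg algebra.
   Context: $I(G)$ is the edge ideal of $G$, generated by the monomials $ab$ with $\{a,b\}\in E(G)$. A threshold graph is a graph obtained from the empty graph by performing a finite sequence made up of the following two operations: (1) introduce an isolated vertex to the current graph; (2) add a new vertex adjacent to every vertex of the current graph. A dg $Q$-algebra is a nonnegatively graded associative unital $Q$-algebra with degree-$0$ part $Q$ and a degree $-1$ differential satisfying $\partial(ab)=\partial(a)b+(-1)^{|a|}a\partial(b)$; it is strictly commutative if $ab=(-1)^{|a||b|}ba$ for homogeneous $a,b$ and $a^2=0$ for $|a|$ odd. A resolution admits the structure of a dg algebra if there is a multiplication on it making it, with its given differential, a dg algebra. (In the section containing this result, the paper writes ''dg algebra'' for ''strictly commutative dg algebra''.) *)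

(* Defs.v *)
From HB Require Import structures.
From mathcomp Require Import all_boot all_order all_algebra.
From mathcomp.multinomials Require Import mpoly.

Set Implicit Arguments.
Unset Strict Implicit.
Unset Printing Implicit Defensive.

Import GRing.Theory.
Local Open Scope ring_scope.

Section Threshold.
Variable V : finType.
Implicit Types (S : {set V}) (E : rel V).

(* [threshold_build S E]: the graph with vertex set [S] and adjacency [E] is
   obtained from the graph with no vertices by adding, one at a time, vertices
   of [V] that are isolated, resp. adjacent to all the vertices added before. *)
Inductive threshold_build : {set V} -> rel V -> Prop :=
| threshold_empty :
    threshold_build set0 (fun _ _ => false)
| threshold_isolated S E v :
    v \notin S -> threshold_build S E -> threshold_build (v |: S) E
| threshold_dominating S E v :
    v \notin S -> threshold_build S E ->
    threshold_build (v |: S)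
      (fun x y => [|| E x y, (x == v) && (y \in S) | (x \in S) && (y == v)]).

Definition threshold (E : rel V) : Prop :=
  exists2 E' : rel V, threshold_build [set: V] E' & E' =2 E.

Lemma threshold_simple E : threshold E -> ssrbool.symmetric E /\ irreflexive E.
Proof.
case=> E' bE' eqE.
suff [symE irrE]: ssrbool.symmetric E' /\ irreflexive E'.
  by split=> [x y | x]; rewrite -!eqE.
elim: bE' => // {E E' eqE} S E v vS _ [symE irrE]; split=> [x y | x].
  by rewrite symE; congr (_ || _); rewrite orbC; congr (_ || _); rewrite andbC.
rewrite irrE /= andbC orbb; apply/negP => /andP[xS /eqP xv].
by rewrite -xv xS in vS.
Qed.

End Threshold.

(* In k[V] the vertex [v] is the variable ['X_(enum_rank v)]. *)
Definition edge_ideal (k : fieldType) (V : finType) (E : rel V)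
    (p : {mpoly k[#|V|]}) : Prop :=
  exists c : V -> V -> {mpoly k[#|V|]},
    p = \sum_u \sum_(v | E u v)
          c u v * ('X_(enum_rank u) * 'X_(enum_rank v)).

Section GradedComplexes.
Variables (k : fieldType) (n : nat).
Local Notation Q := {mpoly k[n]}.

(* The zero polynomial is homogeneous of every degree, and is the only one
   homogeneous of negative degree. *)
Definition homog_of_deg (d : int) (p : Q) : Prop :=
  forall m, m \in msupp p -> (mdeg m)%:Z = d.

(* Complexes  ... -> F_2 -> F_1 -> F_0  of finitely generated graded free
   Q-modules.  F_i is the module of row vectors ['rV[Q]_(rk i)], whose j-th
   basis vector has degree [shift i j]; the differential F_(i+1) -> F_i is
   right multiplication by [diff i]. *)
Record gfcomplex := GFComplex {
  rk : nat -> nat;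
  shift : forall i, 'I_(rk i) -> int;
  diff : forall i, 'M[Q]_(rk i.+1, rk i);
  diff_homog : forall i (r : 'I_(rk i.+1)) (c : 'I_(rk i)),
    homog_of_deg (shift r - shift c) (diff i r c);
  diff_diff : forall i, diff i.+1 *m diff i = 0
}.

Definition fmod (F : gfcomplex) (i : nat) := 'rV[Q]_(rk F i).

Definition bd (F : gfcomplex) (i : nat) (x : fmod F i.+1) : fmod F i :=
  x *m diff F i.

(* [F] is a graded free resolution of Q/I.  The augmentation F_0 -> Q/I is
   given by a lift F_0 -> Q, right multiplication by the column [aug]. *)
Definition resolves (F : gfcomplex) (I : Q -> Prop) : Prop :=
  exists aug : 'cV[Q]_(rk F 0),
    [/\ forall j, homog_of_deg (shift j) (aug j ord0),
        forall q : Q, exists x : fmod F 0, I ((x *m aug) ord0 ord0 - q),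
        forall x : fmod F 0,
          I ((x *m aug) ord0 ord0) <-> exists y : fmod F 1, x = bd y
      & forall i (x : fmod F i.+1),
          bd x = 0 -> exists y : fmod F i.+2, x = bd y].

(* The image of each differential lies in m F_i, where m is the ideal of
   polynomials without constant term. *)
Definition minimal (F : gfcomplex) : Prop :=
  forall i (x : fmod F i.+1) (j : 'I_(rk F i)), (bd x ord0 j)@_0%MM = 0.

(* A product F_i x F_j -> F_l for each equation [i + j = l].  Equations in nat
   being proof-irrelevant, this is the same as a product with values in
   F_(i+j), but no transport is needed to state associativity and the like. *)
Definition gmul (F : gfcomplex) : Type :=
  forall i j l : nat, (i + j)%N = l -> fmod F i -> fmod F j -> fmod F l.

(* [mul], with unit [one], makes [F] with its differential an (associative,
   unital) dg Q-algebra with degree 0 part Q.  The Leibniz rule is split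
   according to which factors have degree 0, where the differential vanishes. *)
Record is_dg_algebra (F : gfcomplex) (mul : gmul F) (one : fmod F 0) : Prop :=
  IsDGAlgebra {
  dg_linearl : forall i j l (e : (i + j)%N = l) (q : Q) (x x' : fmod F i)
      (y : fmod F j),
    mul i j l e (q *: x + x') y = q *: mul i j l e x y + mul i j l e x' y;
  dg_linearr : forall i j l (e : (i + j)%N = l) (q : Q) (x : fmod F i)
      (y y' : fmod F j),
    mul i j l e x (q *: y + y') = q *: mul i j l e x y + mul i j l e x y';
  dg_assoc : forall i j l ij jl ijl (e1 : (i + j)%N = ij)
      (e2 : (ij + l)%N = ijl) (e3 : (j + l)%N = jl) (e4 : (i + jl)%N = ijl)
      (x : fmod F i) (y : fmod F j) (z : fmod F l),
    mul ij l ijl e2 (mul i j ij e1 x y) z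
    = mul i jl ijl e4 x (mul j l jl e3 y z);
  dg_unitl : forall i (e : (0 + i)%N = i) (x : fmod F i), mul 0%N i i e one x = x;
  dg_unitr : forall i (e : (i + 0)%N = i) (x : fmod F i), mul i 0%N i e x one = x;
  dg_degree0 : bijective (fun q : Q => (q *: one : fmod F 0));
  dg_leibniz : forall i j l (e : (i.+1 + j.+1)%N = l.+1)
      (e1 : (i + j.+1)%N = l) (e2 : (i.+1 + j)%N = l)
      (x : fmod F i.+1) (y : fmod F j.+1),
    bd (mul i.+1 j.+1 l.+1 e x y)
    = mul i j.+1 l e1 (bd x) y + (-1) ^+ i.+1 *: mul i.+1 j l e2 x (bd y);
  dg_leibniz0l : forall j l (e : (0 + j.+1)%N = l.+1) (e' : (0 + j)%N = l)
      (x : fmod F 0) (y : fmod F j.+1),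
    bd (mul 0%N j.+1 l.+1 e x y) = mul 0%N j l e' x (bd y);
  dg_leibniz0r : forall i l (e : (i.+1 + 0)%N = l.+1) (e' : (i + 0)%N = l)
      (x : fmod F i.+1) (y : fmod F 0),
    bd (mul i.+1 0%N l.+1 e x y) = mul i 0%N l e' (bd x) y
}.

Definition strictly_commutative (F : gfcomplex) (mul : gmul F) : Prop :=
  (forall i j l (e : (i + j)%N = l) (e' : (j + i)%N = l)
      (x : fmod F i) (y : fmod F j),
    mul i j l e x y = (-1) ^+ (i * j)%N *: mul j i l e' y x)
  /\ (forall i l (e : (i + i)%N = l) (x : fmod F i),
    odd i -> mul i i l e x x = 0).

Definition admits_scdg_algebra (F : gfcomplex) : Prop :=
  exists (mul : gmul F) (one : fmod F 0),
    is_dg_algebra mul one /\ strictly_commutative mul.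

End GradedComplexes.

(* Main.v *)
From HB Require Import structures.
Require Import Defs.
From Stdlib Require Import IndefiniteDescription.
From mathcomp Require Import all_boot all_order perm all_algebra.
From mathcomp.multinomials Require Import mpoly.

(* Build the threshold graph vertex by vertex, together with a dg algebra [A]
   resolving [Q/I(G)], the Koszul complex [K] resolving [Q/(S)], where [S] is
   the current set of vertices, and a dg algebra map [phi : A -> K] lifting
   [Q/I(G) -> Q/(S)] and minimal in positive degrees.

   An isolated vertex [x] only replaces [K] with [K<e>], [de = x].  For a
   dominating vertex [x] the new edge ideal is the intersection of [(S)] with
   [I(G) + (x)], so that the new quotient is the fibre product of [Q/(S)] and
   [Q/(I(G), x)] over [Q/(S, x)].  Since [K -> K/xK] is surjective, the strict
   fibre product of [A<e>] and [K] over [K/xK] is a dg algebra with this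
   homology.  Its subalgebra reduced to [Q] in degree 0, and in degree 1 to the
   elements whose differential lies in [Q], is still a resolution; it is free
   and minimal, and, being a subalgebra of [A<e> x K], inherits associativity,
   the Leibniz rule and strict commutativity.

   Minimal graded free resolutions being unique up to isomorphism, the product
   is finally transported to the given resolution. *)

Set Implicit Arguments.
Unset Strict Implicit.
Unset Printing Implicit Defensive.

Import GRing.Theory.
Local Open Scope ring_scope.

(** * Homogeneous polynomials and uniqueness of minimal resolutions *)

Section Homogeneous.
Variables (k : fieldType) (n : nat).
Local Notation Q := {mpoly k[n]}.
Implicit Types (p q : Q) (m : 'X_{1..n}) (d e : int).

Lemma homogP d p :
  homog_of_deg d p <-> forall m, p@_m != 0 -> (mdeg m)%:Z = d.
Proof. by split=> h m; have := h m; rewrite mcoeff_msupp. Qed.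

Lemma homog0 d : homog_of_deg d (0 : Q).
Proof. by apply/homogP=> m; rewrite mcoeff0 eqxx. Qed.

Lemma homogD d p q :
  homog_of_deg d p -> homog_of_deg d q -> homog_of_deg d (p + q).
Proof.
move=> /homogP hp /homogP hq; apply/homogP=> m; rewrite mcoeffD.
by have [->|/hp //] := eqVneq p@_m 0; rewrite add0r; apply: hq.
Qed.

Lemma homogM d e p q :
  homog_of_deg d p -> homog_of_deg e q -> homog_of_deg (d + e) (p * q).
Proof.
move=> hp hq m /msuppM_le /allpairsP[[m1 m2] /= [/hp <- /hq <- ->]].
by rewrite mdegD.
Qed.

Lemma homogC (c : k) : homog_of_deg 0 (c%:MP : Q).
Proof.
apply/homogP=> m; rewrite mcoeffC.
by have [->|] := eqVneq m 0%MM; rewrite ?mdeg0 // mulr0 eqxx.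
Qed.

Lemma homogX (i : 'I_n) : homog_of_deg 1 ('X_i : Q).
Proof. by move=> m; rewrite msuppX inE => /eqP->; rewrite mdeg1. Qed.

Lemma homog_sum (I : Type) (r : seq I) (P : pred I) (f : I -> Q) d :
  (forall i, P i -> homog_of_deg d (f i)) ->
  homog_of_deg d (\sum_(i <- r | P i) f i).
Proof. by move=> h; elim/big_ind: _ => //; [exact: homog0 | exact: homogD]. Qed.

Lemma homog_prod (I : Type) (r : seq I) (P : pred I) (f : I -> Q) (g : I -> int) :
  (forall i, P i -> homog_of_deg (g i) (f i)) ->
  homog_of_deg (\sum_(i <- r | P i) g i) (\prod_(i <- r | P i) f i).
Proof.
move=> h; elim/big_rec2: _ => [|i p d Pi]; first by rewrite -mpolyC1; apply: homogC.
by apply/homogM/h.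
Qed.

Lemma homog_deg0 p : homog_of_deg 0 p -> p = (p@_0%MM)%:MP.
Proof.
move=> /homogP h; apply/mpolyP=> m; rewrite mcoeffC.
have [->|m0] := eqVneq m 0%MM; rewrite ?mulr1 // mulr0.
by apply: contraNeq m0 => /h[/eqP]; rewrite mdeg_eq0.
Qed.

(** Serves twice: with a degree condition it extracts homogeneous components, with a set of
    exponents it splits a polynomial along a sum of monomial ideals. *)
Definition mfilter (P : pred 'X_{1..n}) p : Q :=
  \sum_(m <- msupp p | P m) p@_m *: 'X_[m].

Lemma mcoeff_mfilter P p m :
  (mfilter P p)@_m = if P m then p@_m else 0.
Proof.
rewrite /mfilter raddf_sum /=.
under eq_bigr do rewrite mcoeffZ mcoeffX mulr_natr mulrb.
have [mp|mp] := boolP (m \in msupp p); last first.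
  rewrite big_seq_cond big1 ?(memN_msupp_eq0 mp) ?if_same // => m' /andP[m'p _].
  by case: eqP => // mm'; rewrite -mm' m'p in mp.
rewrite big_mkcond (bigD1_seq m) ?msupp_uniq //= eqxx big1 ?addr0 // => m' nm.
by rewrite (negPf nm) if_same.
Qed.

Definition hcomp d : Q -> Q := mfilter (fun m => (mdeg m)%:Z == d).

Lemma hcomp_homog d p : homog_of_deg d (hcomp d p).
Proof.
by apply/homogP=> m; rewrite mcoeff_mfilter; case: ifP => [/eqP //|_]; rewrite eqxx.
Qed.

Lemma hcomp_id d p : homog_of_deg d p -> hcomp d p = p.
Proof.
move=> /homogP h; apply/mpolyP=> m; rewrite mcoeff_mfilter.
by case: eqP => // nd; apply/esym/eqP; apply: contraT => /h.
Qed.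

Lemma hcomp_is_additive d : additive (hcomp d).
Proof.
move=> p q; apply/mpolyP=> m; rewrite mcoeffB !mcoeff_mfilter mcoeffB.
by case: ifP => //; rewrite subr0.
Qed.

HB.instance Definition _ d :=
  GRing.isAdditive.Build Q Q (hcomp d) (hcomp_is_additive d).

Lemma hcompM d e p q :
  homog_of_deg e q -> hcomp d (p * q) = hcomp (d - e) p * q.
Proof.
move=> /homogP hq; apply/mpolyP=> m.
rewrite mcoeff_mfilter !mcoeffM.
case: eqP => [md|nmd]; last first.
  rewrite big1 // => mm /eqP def_m; rewrite mcoeff_mfilter.
  case: eqP => [m1|]; rewrite ?mul0r //.
  have [->|/hq m2] := eqVneq q@_mm.2 0; first by rewrite mulr0.
  by case: nmd; rewrite def_m mdegD PoszD m1 m2 subrK.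
apply: eq_bigr => mm /eqP def_m; rewrite mcoeff_mfilter.
have [->|/hq m2] := eqVneq q@_mm.2 0; first by rewrite !mulr0.
have: (mdeg m)%:Z = (mdeg mm.1)%:Z + e by rewrite [in LHS]def_m mdegD PoszD m2.
by rewrite md => ->; rewrite addrK eqxx.
Qed.

End Homogeneous.

(** * Homogeneous matrices and the graded Nakayama lemma *)

Section HomogeneousMatrices.
Variables (k : fieldType) (n : nat).
Local Notation Q := {mpoly k[n]}.

(** These are the matrices of degree-preserving maps between graded free modules with generators in
    degrees [s] and [t]. *)
Definition homog_mx a b (s : 'I_a -> int) (t : 'I_b -> int) (A : 'M[Q]_(a, b)) :=
  forall i j, homog_of_deg (s i - t j) (A i j).

Lemma homog_mxM a b c (s : 'I_a -> int) (t : 'I_b -> int) (u : 'I_c -> int)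
    (A : 'M[Q]_(a, b)) (B : 'M[Q]_(b, c)) :
  homog_mx s t A -> homog_mx t u B -> homog_mx s u (A *m B).
Proof.
move=> hA hB i j; rewrite mxE; apply: homog_sum => l _.
by rewrite -(subrKA (t l)); apply: homogM.
Qed.

(** In each term of the Leibniz expansion the degrees [s i - s (p i)] add up to 0, [p] being a
    permutation. *)
Lemma homog_det a (s : 'I_a -> int) (A : 'M[Q]_a) :
  homog_mx s s A -> homog_of_deg 0 (\det A).
Proof.
move=> hA; apply: homog_sum => p _; rewrite -[0]add0r; apply: homogM.
  by rewrite -mpolyC1 -mpolyCN -rmorphXn; apply: homogC.
have <- : \sum_i (s i - s (p i)) = 0.
  by rewrite sumrB (reindex_inj (@perm_inj _ p)) subrr.
exact: homog_prod.
Qed.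

(** The determinant is homogeneous of degree 0, hence a constant, and can be computed modulo the
    maximal ideal. *)
Lemma homog_unitmx a (s : 'I_a -> int) (A : 'M[Q]_a) :
  homog_mx s s A -> map_mx (mcoeff 0%MM) A = 1%:M -> A \in unitmx.
Proof.
move=> hA A1; rewrite unitmxE (homog_deg0 (homog_det hA)).
by rewrite -det_map_mx A1 det1 unitr1.
Qed.

(** The given preimages of the rows of [U] may be inhomogeneous. Keeping only the component of the
    right degree in each entry repairs this, since [W] is graded and [U], [D] are homogeneous. *)
Lemma homog_lift a b c (s : 'I_a -> int) (t : 'I_b -> int) (u : 'I_c -> int)
    (W : 'rV[Q]_c -> Prop) (U : 'M[Q]_(a, c)) (D : 'M[Q]_(b, c)) :
  W 0 -> (forall q x y, W x -> W y -> W (q *: x + y)) ->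
  (forall d x, W x -> W (\row_j hcomp (d - u j) (x ord0 j))) ->
  homog_mx s u U -> homog_mx t u D ->
  (forall i, exists x, W (x *m D - row i U)) ->
  exists2 A, homog_mx s t A & forall x, W (x *m (A *m D - U)).
Proof.
move=> W0 WD Wh hU hD /fin_all_exists[x xP].
exists (\matrix_(i, j) hcomp (s i - t j) (x i ord0 j)).
  by move=> i j; rewrite mxE; apply: hcomp_homog.
move=> y; rewrite mulmx_sum_row; elim/big_ind: _ => // [v w Wv Ww | i _].
  by rewrite -[v]scale1r; apply: WD.
rewrite -[_ *: _]addr0; apply: WD => //.
suff -> : row i (\matrix_(i, j) hcomp (s i - t j) (x i ord0 j) *m D - U)
  = \row_j hcomp (s i - u j) ((x i *m D - row i U) ord0 j) by apply: Wh.
apply/rowP=> j; rewrite !mxE raddfB /= (hcomp_id (hU i j)) raddf_sum /=.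
congr (_ - _); apply: eq_bigr => l _.
rewrite (hcompM _ _ (hD l j)) mxE; congr (hcomp _ _ * _).
by rewrite opprB addrA subrK.
Qed.

(* The two lifts [A] and [B] of each other's generators satisfy
   [A *m B = 1] modulo the maximal ideal, so they are invertible by the
   homogeneous form of Nakayama's lemma. *)
Lemma homog_cover_unique a b c (s : 'I_a -> int) (t : 'I_b -> int)
    (u : 'I_c -> int) (W : 'rV[Q]_c -> Prop)
    (U : 'M[Q]_(a, c)) (D : 'M[Q]_(b, c)) :
  W 0 -> (forall q x y, W x -> W y -> W (q *: x + y)) ->
  (forall d x, W x -> W (\row_j hcomp (d - u j) (x ord0 j))) ->
  homog_mx s u U -> homog_mx t u D ->
  (forall i, exists x, W (x *m D - row i U)) ->
  (forall i, exists x, W (x *m U - row i D)) ->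
  (forall x, W (x *m U) -> forall j, (x ord0 j)@_0%MM = 0) ->
  (forall x, W (x *m D) -> forall j, (x ord0 j)@_0%MM = 0) ->
  exists A : 'M[Q]_(a, b),
    [/\ homog_mx s t A, exists2 B, A *m B = 1%:M & B *m A = 1%:M
      & forall x, W (x *m (A *m D - U))].
Proof.
move=> W0 WD Wh hU hD UD DU kU kD.
have [A hA AP] := homog_lift W0 WD Wh hU hD UD.
have [B hB BP] := homog_lift W0 WD Wh hD hU DU.
have unit_mul a' b' (s' : 'I_a' -> int) (t' : 'I_b' -> int)
    (U' : 'M[Q]_(a', c)) (D' : 'M[Q]_(b', c)) A' B' :
    (forall x, W (x *m U') -> forall j, (x ord0 j)@_0%MM = 0) ->
    homog_mx s' t' A' -> homog_mx t' s' B' ->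
    (forall x, W (x *m (A' *m D' - U'))) ->
    (forall x, W (x *m (B' *m U' - D'))) -> A' *m B' \in unitmx.
  move=> kU' hA' hB' AP' BP'; apply: (homog_unitmx (homog_mxM hA' hB')).
  (* The rows of [(A' *m B' - 1) *m U'] lie in [W], so [kU'] kills the constant terms of
     [A' *m B' - 1]. *)
  have k0 i j : ((A' *m B' - 1%:M) i j)@_0%MM = 0.
    have := kU' (row i (A' *m B' - 1%:M)) _ j; rewrite mxE; apply.
    rewrite rowE -mulmxA mulmxBl mul1mx.
    have -> : A' *m B' *m U' - U'
        = A' *m (B' *m U' - D') + (A' *m D' - U').
      by rewrite mulmxBr mulmxA addrA subrK.
    by rewrite mulmxDr mulmxA -[_ *m (_ - D')]scale1r; apply: WD.
  apply/matrixP=> i j; have /eqP := k0 i j.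
  rewrite !mxE mcoeffB subr_eq0 => /eqP ->.
  by case: (i == j); rewrite ?mcoeff0 // mcoeff1 eqxx.
have uAB := unit_mul _ _ _ _ _ _ _ _ kU hA hB AP BP.
have uBA := unit_mul _ _ _ _ _ _ _ _ kD hB hA BP AP.
(* [A] is not known to be square: a right inverse comes from [A *m B], and cancelling [B *m A] shows
   that it is also a left inverse. *)
exists A; split=> //; exists (B *m invmx (A *m B)); first by rewrite mulmxA mulmxV.
apply: (can_inj (mulKmx uBA)).
by rewrite !mulmxA -(mulmxA B A B) mulmx1 -[B *m _ *m _]mulmxA mulmxV ?mulmx1.
Qed.

End HomogeneousMatrices.

(** Dependent choice along a family of types, for building a chain map whose matrix in each degree
    depends on the previous one. *)
Lemma dependent_choice_seq (X : nat -> Type) (P : forall i, X i -> Prop)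
    (R : forall i, X i -> X i.+1 -> Prop) :
  (exists x, P 0%N x) ->
  (forall i x, P i x -> exists2 y, P i.+1 y & R i x y) ->
  exists f : forall i, X i, forall i, P i (f i) /\ R i (f i) (f i.+1).
Proof.
move=> x0P step; have x0 := constructive_indefinite_description _ x0P.
have next i (x : {x | P i x}) : {y : {y | P i.+1 y} | R i (sval x) (sval y)}.
  apply: constructive_indefinite_description; case: x => x Px.
  have [y Py Rxy] := step i x Px.
  by exists (exist _ y Py).
pose f := nat_rect (fun i => {x | P i x}) x0 (fun i x => sval (next i x)).
exists (fun i => sval (f i)) => i; split; first exact: svalP (f i).
exact: svalP (next i (f i)).
Qed.

(** * Uniqueness of minimal graded free resolutions *)

Section MinimalResolutions.
Variables (k : fieldType) (n : nat).
Local Notation Q := {mpoly k[n]}.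

Record graded_ideal (I : Q -> Prop) : Prop := GradedIdeal {
  graded_ideal0 : I 0;
  graded_idealD : forall q p r, I p -> I r -> I (q * p + r);
  graded_ideal_hcomp : forall d p, I p -> I (hcomp d p)
}.

Lemma graded_idealB I : graded_ideal I -> forall p q, I (p - q) -> I p <-> I q.
Proof.
move=> gI p q Ipq; split=> [Ip | Iq].
  by rewrite -(subKr p q) addrC -mulN1r; apply: graded_idealD.
by rewrite -(subrK q p) -[p - q]mul1r; apply: graded_idealD.
Qed.

(** The augmentation to [Q/I] plays the role of the differential out of degree 0, so that all
    degrees are treated alike. *)
Definition cycle (F : gfcomplex k n) (I : Q -> Prop) (aug : 'cV[Q]_(rk F 0)) i :
    fmod F i -> Prop :=
  match i with
  | 0 => fun x => I ((x *m aug) ord0 ord0)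
  | i.+1 => fun x => bd x = 0
  end.

(** The isomorphism is built degree by degree. Since each matrix matches the cycles of [F] with
    those of [M], the next differentials of [F] and [M] are two minimal systems of generators of one
    module, to which [homog_cover_unique] applies. *)
Lemma minimal_resolution_unique (F M : gfcomplex k n) (I : Q -> Prop) :
  graded_ideal I -> resolves F I -> resolves M I -> minimal F -> minimal M ->
  exists A : forall i, 'M[Q]_(rk F i, rk M i), forall i,
    (exists2 B, A i *m B = 1%:M & B *m A i = 1%:M) /\
    A i.+1 *m diff M i = diff F i *m A i.
Proof.
move=> gI resF resM minF minM.
have [augF [hF surjF exF0 exF]] := resF; have [augM [hM surjM exM0 exM]] := resM.
have cycleF i (x : fmod F i) : cycle I augF x <-> exists y, x = bd y.
  case: i x => //= i x; split=> [/exF //|[y ->]].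
  by rewrite /bd -mulmxA diff_diff mulmx0.
have cycleM i (x : fmod M i) : cycle I augM x <-> exists y, x = bd y.
  case: i x => //= i x; split=> [/exM //|[y ->]].
  by rewrite /bd -mulmxA diff_diff mulmx0.
pose good i (A : 'M[Q]_(rk F i, rk M i)) := [/\
  homog_mx (@shift _ _ F i) (@shift _ _ M i) A,
  exists2 B, A *m B = 1%:M & B *m A = 1%:M
  & forall x : fmod F i, cycle I augF x <-> cycle I augM (x *m A)].
have [||A AP] := @dependent_choice_seq _ good
  (fun i A A' => A' *m diff M i = diff F i *m A).
(* In degree 0 the augmentations are compared modulo [I]; their kernels consist of boundaries, which
   have no constant terms by minimality. *)
- pose W (x : 'rV[Q]_1) := I (x ord0 ord0).
  have [|||||||||A [hA iA AP]] := @homog_cover_unique k n _ _ _ (@shift _ _ F 0)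
      (@shift _ _ M 0) (fun=> 0) W augF augM; rewrite /W.
  + by rewrite mxE; apply: graded_ideal0.
  + by move=> q x y; rewrite !mxE; apply: graded_idealD.
  + by move=> d x; rewrite mxE subr0; apply: graded_ideal_hcomp.
  + by move=> i j; rewrite ord1 subr0; apply: hF.
  + by move=> i j; rewrite ord1 subr0; apply: hM.
  + move=> i; have [x xP] := surjM (augF i ord0).
    by exists x; rewrite !mxE in xP *.
  + move=> i; have [x xP] := surjF (augM i ord0).
    by exists x; rewrite !mxE in xP *.
  + by move=> x /exF0[y ->]; apply: minF.
  + by move=> x /exM0[y ->]; apply: minM.
  exists A; split=> // x /=; have := AP x; rewrite mulmxBr mulmxA /W !mxE.
  by move=> h; apply: iff_sym; apply: (graded_idealB gI) h.
(* In positive degree the comparison is exact: after transport along [A], both differentials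
   generate the cycles of [M] in degree [i]. *)
- move=> i A [hA [B AB BA] AP].
  pose W (x : 'rV[Q]_(rk M i)) := x = 0.
  have cU (x : fmod F i.+1) : x *m (diff F i *m A) = 0 -> bd x = 0.
    by move=> /(congr1 (mulmx^~ B)); rewrite mul0mx mulmxA -mulmxA AB mulmx1.
  have [|||||||||A' [hA' iA' A'P]] := @homog_cover_unique k n _ _ _
      (@shift _ _ F i.+1) (@shift _ _ M i.+1) (@shift _ _ M i) W
      (diff F i *m A) (diff M i); rewrite /W.
  + by [].
  + by move=> q x y -> ->; rewrite scaler0 addr0.
  + by move=> d x ->; apply/rowP=> j; rewrite !mxE raddf0.
  + exact: homog_mxM (@diff_homog _ _ F i) hA.
  + exact: diff_homog.
  + move=> r; have /cycleM[y yP]: cycle I augM (row r (diff F i) *m A).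
      by apply/AP/cycleF; exists (delta_mx ord0 r); rewrite /bd -rowE.
    by exists y; rewrite row_mul yP subrr.
  + move=> r; have : cycle I augF (row r (diff M i) *m B).
      apply/AP; rewrite -mulmxA BA mulmx1; apply/cycleM.
      by exists (delta_mx ord0 r); rewrite /bd -rowE.
    move=> /cycleF[y yP]; exists y.
    by rewrite mulmxA -[y *m _]/(bd y) -yP -mulmxA BA mulmx1 subrr.
  + by move=> x /cU /exF[y ->]; apply: minF.
  + by move=> x /exM[y ->]; apply: minM.
  have comm : A' *m diff M i = diff F i *m A.
    apply/eqP; rewrite -subr_eq0; apply/eqP/row_matrixP => r.
    by rewrite rowE A'P row0.
  exists A' => //; split=> // x; rewrite /= /bd -mulmxA comm.
  split=> [x0|/cU //]; rewrite mulmxA.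
  by rewrite (_ : x *m diff F i = 0) ?mul0mx.
by exists A => i; have [[_ iA _] cA] := AP i.
Qed.

End MinimalResolutions.

(** * Differential graded algebras *)

Section DGAlgebras.
Variables (k : fieldType) (n : nat).
Local Notation Q := {mpoly k[n]}.

(* The product is defined on the whole module [dg_car]; the homological grading
   is a separate family of submodules, so that several subalgebras of one
   ambient algebra can be considered.  [dg_par] is the involution acting as
   [(-1)^i] in homological degree [i], [dg_hom d] the predicate "of internal
   degree [d]", and [dg_eps] a projection onto the scalars. *)
Record dga_data := DGAData {
  dg_car :> lmodType Q;
  dg_one : dg_car;
  dg_mul : dg_car -> dg_car -> dg_car;
  dg_par : dg_car -> dg_car;
  dg_dif : dg_car -> dg_car;
  dg_eps : dg_car -> Q;
  dg_hom : int -> dg_car -> Prop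
}.

Local Notation "a ** b" := (dg_mul a b) (at level 40, left associativity).

(** Commutativity is left to [dg_grading], as it concerns graded elements. The laws
    [dg_torsion_free] and [dg_hom_divX] on division by a variable make the parametrization [fib] of
    the fibre product injective and compatible with internal degrees. *)
Record dga_laws (A : dga_data) : Prop := DGALaws {
  dg_mul_linearl : forall (q : Q) (a b c : A),
    (q *: a + b) ** c = q *: (a ** c) + b ** c;
  dg_mul_linearr : forall (a : A), linear (dg_mul a);
  dg_mulA : forall a b c : A, a ** (b ** c) = a ** b ** c;
  dg_mul1l : forall a : A, dg_one A ** a = a;
  dg_mul1r : forall a : A, a ** dg_one A = a;
  dg_par_linear : linear (@dg_par A);
  dg_par1 : dg_par (dg_one A) = dg_one A;
  dg_parM : forall a b : A, dg_par (a ** b) = dg_par a ** dg_par b;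
  dg_parK : forall a : A, dg_par (dg_par a) = a;
  dg_dif_linear : linear (@dg_dif A);
  dg_difM : forall a b : A,
    dg_dif (a ** b) = dg_dif a ** b + dg_par a ** dg_dif b;
  dg_difK : forall a : A, dg_dif (dg_dif a) = 0;
  dg_dif_par : forall a : A, dg_dif (dg_par a) = - dg_par (dg_dif a);
  dg_eps_linear : linear (@dg_eps A : A -> Q^o);
  dg_eps1 : dg_eps (dg_one A) = 1;
  dg_torsion_free : forall (i : 'I_n) (a : A), 'X_i *: a = 0 -> a = 0;
  dg_hom0 : forall d, dg_hom d (0 : A);
  dg_homD : forall d (a b : A), dg_hom d a -> dg_hom d b -> dg_hom d (a + b);
  dg_homZ : forall d e q (a : A),
    homog_of_deg d q -> dg_hom e a -> dg_hom (d + e) (q *: a);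
  dg_hom_divX : forall d i (a : A), dg_hom d ('X_i *: a) -> dg_hom (d - 1) a;
  dg_hom1 : dg_hom 0 (dg_one A);
  dg_hom_par : forall d (a : A), dg_hom d a -> dg_hom d (dg_par a);
  dg_hom_dif : forall d (a : A), dg_hom d a -> dg_hom d (dg_dif a);
  dg_hom_eps : forall d (a : A), dg_hom d a -> homog_of_deg d (dg_eps a)
}.

Record dga := DGA { dga_val :> dga_data; dgaP : dga_laws dga_val }.

HB.instance Definition _ (A : dga) (a : A) :=
  GRing.isLinear.Build Q A A *:%R (dg_mul a) (dg_mul_linearr (dgaP A) a).
HB.instance Definition _ (A : dga) :=
  GRing.isLinear.Build Q A A *:%R (@dg_par A) (dg_par_linear (dgaP A)).
HB.instance Definition _ (A : dga) :=
  GRing.isLinear.Build Q A A *:%R (@dg_dif A) (dg_dif_linear (dgaP A)).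
HB.instance Definition _ (A : dga) :=
  GRing.isLinear.Build Q A Q^o *:%R (@dg_eps A) (dg_eps_linear (dgaP A)).

Section DGTheory.
Variable A : dga.
Implicit Types (a b c : A) (q : Q).

Lemma dg_mulDl a b c : (a + b) ** c = a ** c + b ** c.
Proof. by rewrite -[a in LHS]scale1r (dg_mul_linearl (dgaP A)) scale1r. Qed.

Lemma dg_mul0l c : 0 ** c = 0.
Proof. by apply: (addIr (0 ** c)); rewrite -dg_mulDl !add0r. Qed.

Lemma dg_mulZl q a c : (q *: a) ** c = q *: (a ** c).
Proof.
by rewrite -[q *: a]addr0 (dg_mul_linearl (dgaP A)) dg_mul0l addr0.
Qed.

Lemma dg_mulNl a c : - a ** c = - (a ** c).
Proof. by rewrite -scaleN1r dg_mulZl scaleN1r. Qed.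

Lemma dg_homN d a : dg_hom d a -> dg_hom d (- a).
Proof.
rewrite -scaleN1r -[d in X in _ -> X]add0r -mpolyC1 -mpolyCN.
by apply/(dg_homZ (dgaP A))/homogC.
Qed.

Lemma dg_epsZ q a : dg_eps (q *: a) = q * dg_eps a.
Proof. exact: linearZ. Qed.

Lemma dg_eps_scalar q : dg_eps (q *: dg_one A) = q.
Proof. by rewrite dg_epsZ (dg_eps1 (dgaP A)) mulr1. Qed.

Lemma dg_dif1 : dg_dif (dg_one A) = 0.
Proof.
have /eqP := dg_difM (dgaP A) (dg_one A) (dg_one A).
rewrite (dg_par1 (dgaP A)) !(dg_mul1r (dgaP A)) (dg_mul1l (dgaP A)).
by rewrite -subr_eq0 opprD addNKr oppr_eq0 => /eqP.
Qed.

End DGTheory.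

Definition base_data : dga_data :=
  @DGAData Q^o 1 *%R id (fun=> 0) id (@homog_of_deg k n).

Lemma mpolyX_neq0 (i : 'I_n) : 'X_i != 0 :> Q.
Proof.
by apply/negP=> /eqP/(congr1 (mcoeff U_(i)))/eqP; rewrite mcoeffX eqxx mcoeff0 oner_eq0.
Qed.

Lemma homog_divX d (i : 'I_n) (p : Q) :
  homog_of_deg d ('X_i * p) -> homog_of_deg (d - 1) p.
Proof.
move=> hp m mp; have := hp (U_(i) + m)%MM.
rewrite mcoeff_msupp mulrC mcoeffMX -mcoeff_msupp => /(_ mp) <-.
by rewrite mdegD mdeg1 PoszD addrAC subrr add0r.
Qed.

Lemma base_laws : dga_laws base_data.
Proof.
split=> //=.
- by move=> q a b c; rewrite mulrDl -scalerAl.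
- by move=> a q b c; rewrite mulrDr -scalerAr.
- exact: mulrA.
- exact: mul1r.
- exact: mulr1.
- by move=> q a b; rewrite scaler0 addr0.
- by move=> a b; rewrite mul0r mulr0 addr0.
- by rewrite oppr0.
- move=> i a /eqP; rewrite mulf_eq0 (negPf (mpolyX_neq0 i)) /=.
  by move=> /eqP.
- exact: homog0.
- exact: homogD.
- by move=> d e q a; apply: homogM.
- exact: homog_divX.
- by rewrite -mpolyC1; apply: homogC.
- by move=> d _ _; apply: homog0.
Qed.

Definition base_dga := DGA base_laws.

(* The algebra [A<e | de = 'X_i>], where [(a, b)] stands for [a + b e]. *)
Definition adjoin_data (A : dga) (i : 'I_n) : dga_data :=
  @DGAData (A * A)%type (dg_one A, 0)
    (fun u v => (u.1 ** v.1, u.1 ** v.2 + u.2 ** dg_par v.1))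
    (fun u => (dg_par u.1, - dg_par u.2))
    (fun u => (dg_dif u.1 + 'X_i *: dg_par u.2, dg_dif u.2))
    (fun u => dg_eps u.1)
    (fun d u => dg_hom d u.1 /\ dg_hom (d - 1) u.2).

Lemma adjoin_laws (A : dga) (i : 'I_n) : dga_laws (adjoin_data A i).
Proof.
have lA := dgaP A; split; rewrite /dg_mul /dg_par /dg_dif /dg_eps /dg_hom /=.
- move=> q [a a'] [b b'] [c c']; congr (_, _) => /=.
    by rewrite dg_mulDl dg_mulZl.
  by rewrite !dg_mulDl !dg_mulZl scalerDr addrACA.
- move=> [a a'] q [b b'] [c c']; congr (_, _) => /=; rewrite !linearP //=.
  by rewrite scalerDr addrACA.
- move=> [a a'] [b b'] [c c'] /=; congr (_, _); first exact: dg_mulA.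
  rewrite raddfD /= !dg_mulDl (dg_parM lA) !(dg_mulA lA) addrA //.
- by move=> [a a'] /=; rewrite !(dg_mul1l lA) dg_mul0l addr0.
- move=> [a a'] /=.
  by rewrite (dg_par1 lA) !(dg_mul1r lA) raddf0 add0r.
- move=> q [a a'] [b b']; congr (_, _) => /=; rewrite !linearP //=.
- by rewrite /= (dg_par1 lA) raddf0 oppr0.
- move=> [a a'] [b b'] /=; congr (_, _); first by rewrite (dg_parM lA).
  by rewrite raddfD /= !(dg_parM lA) raddfN /= dg_mulNl opprD.
- by move=> [a a'] /=; rewrite raddfN /= !(dg_parK lA) opprK.
- move=> q [a a'] [b b']; congr (_, _) => /=; rewrite !linearP //=.
  by rewrite scalerDr !scalerA mulrC addrACA.
- move=> [a a'] [b b'] /=; congr (_, _) => /=.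
    rewrite (dg_difM lA) dg_mulDl dg_mulZl !raddfD /= !linearZ /=.
    by rewrite !(dg_parM lA) (dg_parK lA) [X in _ + X = _]addrC addrACA.
  rewrite raddfD /= !(dg_difM lA) dg_mulDl dg_mulZl raddfD /= linearZ /=.
  rewrite raddfD /= linearZ /= (dg_parK lA) (dg_dif_par lA) dg_mulNl raddfN /=.
  rewrite dg_mulNl scalerN addrACA [X in _ = X + _]addrAC -[RHS]addrA; congr (_ + _).
  by rewrite [RHS]addrC !addrA subrK.
- move=> [a a'] /=; congr (_, _); rewrite ?(dg_difK lA) //.
  rewrite raddfD /= linearZ /= (dg_difK lA) (dg_dif_par lA) add0r.
  by rewrite scalerN addNr.
- move=> [a a'] /=; congr (_, _); last by rewrite raddfN /= (dg_dif_par lA).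
  by rewrite raddfN raddfD /= linearZ /= opprD scalerN (dg_dif_par lA).
- by move=> q [a a'] [b b'] /=; apply: dg_eps_linear.
- exact: dg_eps1.
- move=> j [a a'] [/(dg_torsion_free lA)-> /(dg_torsion_free lA)-> //].
- by move=> d; split; apply: dg_hom0.
- by move=> d [a a'] [b b'] /= [? ?] [? ?]; split; apply: (dg_homD lA).
- move=> d e q [a a'] hq [/= ha ha']; rewrite -addrA.
  by split; apply: (dg_homZ lA).
- by move=> d j [a a'] [/= /(dg_hom_divX lA) ? /(dg_hom_divX lA) ?].
- by split; [apply: (dg_hom1 lA) | apply: (dg_hom0 lA)].
- move=> d [a a'] /= [ha ha'].
  by split; [|apply: dg_homN]; apply: (dg_hom_par lA).
- move=> d [a a'] /= [ha ha']; split; last exact: (dg_hom_dif lA).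
  apply: (dg_homD lA); first exact: (dg_hom_dif lA).
  rewrite -[d](subrK 1) addrC; apply: (dg_homZ lA); first exact: homogX.
  exact: (dg_hom_par lA).
- by move=> d [a a'] /= [ha _]; apply: (dg_hom_eps lA).
Qed.

(** Scalars are the diagonal multiples of the unit, so the projection of the first factor recovers
    them. *)
Definition dprod_data (A B : dga) : dga_data :=
  @DGAData (A * B)%type (dg_one A, dg_one B)
    (fun u v => (u.1 ** v.1, u.2 ** v.2))
    (fun u => (dg_par u.1, dg_par u.2))
    (fun u => (dg_dif u.1, dg_dif u.2))
    (fun u => dg_eps u.1)
    (fun d u => dg_hom d u.1 /\ dg_hom d u.2).

Lemma dprod_laws (A B : dga) : dga_laws (dprod_data A B).
Proof.
have [lA lB] := (dgaP A, dgaP B).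
split; rewrite /dg_mul /dg_par /dg_dif /dg_eps /dg_hom /=.
- by move=> q [a a'] [b b'] [c c']; congr (_, _); apply: dg_mul_linearl.
- by move=> [a a'] q [b b'] [c c']; congr (_, _); apply: dg_mul_linearr.
- by move=> [a a'] [b b'] [c c']; congr (_, _); apply: dg_mulA.
- by move=> [a a']; congr (_, _); apply: dg_mul1l.
- by move=> [a a']; congr (_, _); apply: dg_mul1r.
- by move=> q [a a'] [b b']; congr (_, _); apply: dg_par_linear.
- by congr (_, _); apply: dg_par1.
- by move=> [a a'] [b b']; congr (_, _); apply: dg_parM.
- by move=> [a a']; congr (_, _); apply: dg_parK.
- by move=> q [a a'] [b b']; congr (_, _); apply: dg_dif_linear.
- by move=> [a a'] [b b']; congr (_, _); apply: dg_difM.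
- by move=> [a a']; congr (_, _); apply: dg_difK.
- by move=> [a a']; congr (_, _); apply: dg_dif_par.
- by move=> q [a a'] [b b']; apply: dg_eps_linear.
- exact: dg_eps1.
- by move=> i [a a'] [/(dg_torsion_free lA)-> /(dg_torsion_free lB)->].
- by move=> d; split; apply: dg_hom0.
- by move=> d [a a'] [b b'] /= [? ?] [? ?]; split; apply: dg_homD.
- by move=> d e q [a a'] hq [/= ha ha']; split; apply: dg_homZ.
- by move=> d i [a a'] [/= /(dg_hom_divX lA) ? /(dg_hom_divX lB) ?].
- by split; apply: dg_hom1.
- by move=> d [a a'] /= [ha ha']; split; apply: dg_hom_par.
- by move=> d [a a'] /= [ha ha']; split; apply: dg_hom_dif.
- by move=> d [a a'] /= [ha _]; apply: (dg_hom_eps lA).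
Qed.

Definition adjoin A i := DGA (adjoin_laws A i).
Definition dprod A B := DGA (dprod_laws A B).

Record dg_grading (A : dga) (gr : nat -> A -> Prop) : Prop := DGGrading {
  gr_0 : forall i, gr i 0;
  gr_lin : forall i q a b, gr i a -> gr i b -> gr i (q *: a + b);
  gr_one : gr 0%N (dg_one A);
  gr_mul : forall i j a b, gr i a -> gr j b -> gr (i + j)%N (a ** b);
  gr_dif : forall i a, gr i.+1 a -> gr i (dg_dif a);
  gr_dif0 : forall a, gr 0%N a -> dg_dif a = 0;
  gr_par : forall i a, gr i a -> dg_par a = (-1) ^+ i *: a;
  gr_eps : forall i a, gr i.+1 a -> dg_eps a = 0;
  gr_comm : forall i j a b,
    gr i a -> gr j b -> a ** b = (-1) ^+ (i * j)%N *: (b ** a);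
  gr_sq : forall i a, odd i -> gr i a -> a ** a = 0
}.

Section Grading.
Variables (A : dga) (gr : nat -> A -> Prop) (grP : dg_grading gr).
Implicit Types (a b : A) (i j : nat).

Lemma gr_Z i q a : gr i a -> gr i (q *: a).
Proof. by rewrite -[q *: a]addr0 => /gr_lin; apply; last exact: gr_0. Qed.

Lemma gr_D i a b : gr i a -> gr i b -> gr i (a + b).
Proof. by rewrite -[a in X in _ -> _ -> X]scale1r; apply: gr_lin. Qed.

Lemma gr_N i a : gr i a -> gr i (- a).
Proof. by rewrite -scaleN1r; apply: gr_Z. Qed.

Lemma gr_parE i a : gr i a -> gr i (dg_par a).
Proof. by move=> ga; rewrite (gr_par grP ga); apply: gr_Z. Qed.

(** The degree condition on [b] in an element [a + b e] of degree [i]: as [e] has degree 1, the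
    coefficient sits one degree lower. *)
Definition shift_gr i b := if i is j.+1 then gr j b else b = 0.

Lemma shift_gr_lin i q a b :
  shift_gr i a -> shift_gr i b -> shift_gr i (q *: a + b).
Proof.
by case: i => [-> -> | i] /=; [rewrite scaler0 addr0 | apply: gr_lin].
Qed.

Lemma shift_gr0 i : shift_gr i 0.
Proof. by case: i => //= i; apply: gr_0. Qed.

Lemma shift_grD i a b : shift_gr i a -> shift_gr i b -> shift_gr i (a + b).
Proof. by rewrite -[a in X in _ -> _ -> X]scale1r; apply: shift_gr_lin. Qed.

Lemma shift_gr_mull i j a b : gr i a -> shift_gr j b -> shift_gr (i + j) (a ** b).
Proof.
case: j => [ga -> | j ga gb] /=; first by rewrite raddf0; apply: shift_gr0.
by rewrite addnS; apply: gr_mul.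
Qed.

Lemma shift_gr_mulr i j a b : shift_gr i a -> gr j b -> shift_gr (i + j) (a ** b).
Proof.
case: i => [-> _ | i ga gb] /=; first by rewrite dg_mul0l; apply: shift_gr0.
exact: gr_mul.
Qed.

(** This is the commutation of [a] with [b e]. The sign for [a] and [b] is [(-1)^(i (j - 1))], and
    moving [e] past [a] contributes the missing [(-1)^i]. *)
Lemma shift_gr_comm i j a b : gr i a -> shift_gr j b ->
  a ** b = (-1) ^+ (i * j)%N *: (b ** dg_par a).
Proof.
case: j => [_ -> | j ga gb]; first by rewrite raddf0 dg_mul0l scaler0.
rewrite (gr_par grP ga) linearZ /= scalerA -exprD mulnS -addnAC.
rewrite exprD addnn -signr_odd odd_double mul1r; exact: (gr_comm grP).
Qed.

End Grading.

Definition adjoin_gr (A : dga) (gr : nat -> A -> Prop) v i (u : adjoin A v) :=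
  gr i u.1 /\ shift_gr gr i u.2.

Lemma adjoin_grading (A : dga) (gr : nat -> A -> Prop) v :
  dg_grading gr -> dg_grading (@adjoin_gr A gr v).
Proof.
move=> gP; have sgr_par i b : shift_gr gr i b -> shift_gr gr i (dg_par b).
  by case: i => [-> | i]; [rewrite raddf0 | apply: (gr_parE gP)].
split.
- by move=> i; split; [apply: (gr_0 gP) | apply: shift_gr0].
- move=> i q [a a'] [b b'] [/= ? ?] [/= ? ?].
  by split; [apply: (gr_lin gP) | apply: (shift_gr_lin gP)].
- by split; [apply: (gr_one gP)|].
- move=> i j [a a'] [b b'] [/= ga ga'] [/= gb gb']; split; first exact: (gr_mul gP).
  apply: shift_grD => //; first exact: (shift_gr_mull gP).
  by apply: (shift_gr_mulr gP) => //; apply: (gr_parE gP).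
- move=> i [a a'] [/= ga ga']; split.
    by apply: (gr_D gP) => //; [apply: (gr_dif gP) | apply/(gr_Z gP)/(gr_parE gP)].
  by case: i ga' {ga} => [/(gr_dif0 gP)|i /(gr_dif gP)].
- move=> [a a'] [/= ga ->]; congr (_, _) => /=; last exact: raddf0.
  by rewrite (gr_dif0 gP ga) raddf0 scaler0 addr0.
- move=> i [a a'] [/= ga ga']; congr (_, _); first exact: (gr_par gP).
  case: i ga' {ga} => [|i] /=; first by move->; rewrite !raddf0.
  by move=> /(gr_par gP) ->; rewrite exprS mulN1r scaleNr.
- by move=> i [a a'] [/= /(gr_eps gP)].
- move=> i j [a a'] [b b'] [/= ga ga'] [/= gb gb']; congr (_, _) => /=.
    exact: (gr_comm gP).
  rewrite scalerDr (shift_gr_comm gP ga gb') (shift_gr_comm gP gb ga') addrC.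
  by rewrite scalerA [(j * i)%N]mulnC -expr2 sqrr_sign scale1r.
- move=> i [a a'] oi [/= ga ga']; congr (_, _) => /=; first exact: (gr_sq gP) ga.
  (* The coefficient of [e] in the square is [a a' + a' par(a)]; for [i] odd its terms cancel, in
     every characteristic. *)
  rewrite (shift_gr_comm gP ga ga') -signr_odd oddM oi scaleN1r.
  by rewrite addNr.
Qed.

Definition dprod_gr (A B : dga) (grA : nat -> A -> Prop)
    (grB : nat -> B -> Prop) i (u : dprod A B) : Prop :=
  grA i u.1 /\ grB i u.2.

Lemma dprod_grading (A B : dga) (grA : nat -> A -> Prop) (grB : nat -> B -> Prop) :
  dg_grading grA -> dg_grading grB -> dg_grading (@dprod_gr A B grA grB).
Proof.
move=> gA gB; split.
- by move=> i; split; by [apply: (gr_0 gA) | apply: (gr_0 gB)].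
- by move=> i q [a a'] [b b'] [/= ? ?] [/= ? ?]; split; by [apply: (gr_lin gA) | apply: (gr_lin gB)].
- by split; [apply: (gr_one gA) | apply: (gr_one gB)].
- by move=> i j [a a'] [b b'] [/= ? ?] [/= ? ?]; split; by [apply: (gr_mul gA) | apply: (gr_mul gB)].
- by move=> i [a a'] [/= ? ?]; split; by [apply: (gr_dif gA) | apply: (gr_dif gB)].
- by move=> [a a'] [/= ? ?]; congr (_, _); [apply: (gr_dif0 gA) | apply: (gr_dif0 gB)].
- by move=> i [a a'] [/= ? ?]; congr (_, _); [apply: (gr_par gA) | apply: (gr_par gB)].
- by move=> i [a a'] [/= /(gr_eps gA)].
- move=> i j [a a'] [b b'] [/= ? ?] [/= ? ?].
  by congr (_, _); [apply: (gr_comm gA) | apply: (gr_comm gB)].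
- by move=> i [a a'] oi [/= ? ?]; congr (_, _); [apply: (gr_sq gA) oi _ | apply: (gr_sq gB) oi _].
Qed.

End DGAlgebras.

(** * Dg algebra resolutions *)

Section HomogeneousBases.
Variables (k : fieldType) (n : nat).
Local Notation Q := {mpoly k[n]}.

(** A homogeneous basis of the submodule [P]. Requiring homogeneous coordinates for homogeneous
    elements stands in for a decomposition of [U] by internal degree. *)
Definition hom_basis (U : lmodType Q) (H : int -> U -> Prop) (P : U -> Prop)
    (X : finType) (s : X -> int) (e : X -> U) : Prop :=
  [/\ forall x, P (e x), forall x, H (s x) (e x),
      forall c : X -> Q, \sum_x c x *: e x = 0 -> forall x, c x = 0
    & forall u, P u -> exists2 c : X -> Q, u = \sum_x c x *: e x
        & forall d, H d u -> forall x, homog_of_deg (d - s x) (c x)].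

Definition hom_free (U : lmodType Q) (H : int -> U -> Prop) (P : U -> Prop) :=
  exists (X : finType) (s : X -> int) (e : X -> U), hom_basis H P s e.

Lemma eq_hom_free (U : lmodType Q) (H : int -> U -> Prop) (P P' : U -> Prop) :
  (forall u, P u <-> P' u) -> hom_free H P -> hom_free H P'.
Proof.
move=> PP' [X [s [e [Pe He fe ge]]]]; exists X, s, e; split=> // [x|u /PP' /ge //].
exact/PP'.
Qed.

Lemma linear_at0 (U V : lmodType Q) (f : U -> V) : linear f -> f 0 = 0.
Proof. by move=> /(_ (-1) 0 0); rewrite scaleN1r oppr0 addr0 scaleN1r addNr. Qed.

Lemma linear_comb (U V : lmodType Q) (f : U -> V) (X : finType)
    (c : X -> Q) (e : X -> U) :
  linear f -> f (\sum_x c x *: e x) = \sum_x c x *: f (e x).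
Proof.
move=> lf; pose fl : {linear U -> V} := HB.pack f (GRing.isLinear.Build Q U V *:%R f lf).
rewrite -[f]/(fl : U -> V) linear_sum; apply: eq_bigr => x _; exact: linearZ.
Qed.

(** Bases are concatenated along a direct sum. The shifts [s] and [t] account for the internal
    degree of [e], or of the factor ['X_v] in the fibre product. *)
Lemma hom_free_sum (U V W : lmodType Q) (HU : int -> U -> Prop)
    (HV : int -> V -> Prop) (HW : int -> W -> Prop) (PU : U -> Prop)
    (PV : V -> Prop) (PW : W -> Prop) (f : U -> W) (g : V -> W) (s t : int) :
  linear f -> linear g -> PU 0 -> PV 0 ->
  (forall w, PW w <-> exists u v, [/\ PU u, PV v & w = f u + g v]) ->
  (forall u v, f u + g v = 0 -> u = 0 /\ v = 0) ->
  (forall d u, HU d u -> HW (d + s) (f u)) ->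
  (forall d v, HV d v -> HW (d + t) (g v)) ->
  (forall d u v, HW d (f u + g v) -> HU (d - s) u /\ HV (d - t) v) ->
  hom_free HU PU -> hom_free HV PV -> hom_free HW PW.
Proof.
move=> lf lg U0 V0 PWE fg0 Hf Hg Hfg [X [sX [eX [PX HX fX gX]]]].
move=> [Y [sY [eY [PY HY fY gY]]]].
have f0 := linear_at0 lf.
have g0 := linear_at0 lg.
exists (X + Y)%type, (fun z => match z with inl x => sX x + s | inr y => sY y + t end),
  (fun z => match z with inl x => f (eX x) | inr y => g (eY y) end).
split.
- case=> [x|y]; apply/PWE.
    by exists (eX x), 0; split; rewrite ?g0 ?addr0.
  by exists 0, (eY y); split; rewrite ?f0 ?add0r.
- by case=> [x|y]; [apply: Hf | apply: Hg].
- move=> c; rewrite big_sumType /= -(linear_comb _ _ lf) -(linear_comb _ _ lg).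
  by move=> /fg0[/fX cX /fY cY] [x|y].
- move=> w /PWE[u [v [/gX[c -> cH] /gY[c' -> c'H] ->]]].
  exists (fun z => match z with inl x => c x | inr y => c' y end).
    by rewrite big_sumType /= (linear_comb _ _ lf) (linear_comb _ _ lg).
  move=> d /Hfg[/cH hc /c'H hc'] [x|y].
    by rewrite [sX x + s]addrC opprD addrA.
  by rewrite [sY y + t]addrC opprD addrA.
Qed.

(* [a] lies in [m P], for [m] the ideal generated by the variables. *)
Definition in_max (U : lmodType Q) (P : U -> Prop) (a : U) : Prop :=
  exists2 u : 'I_n -> U, forall i, P (u i) & a = \sum_i 'X_i *: u i.

Lemma in_max_map (U V : lmodType Q) (P : U -> Prop) (P' : V -> Prop)
    (f : U -> V) a :
  linear f -> (forall u, P u -> P' (f u)) -> in_max P a -> in_max P' (f a).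
Proof.
move=> lf fP [u uP ->]; exists (f \o u) => [i|]; first exact/fP/uP.
exact: linear_comb.
Qed.

Lemma in_maxD (U : lmodType Q) (P : U -> Prop) a b :
  (forall u v, P u -> P v -> P (u + v)) ->
  in_max P a -> in_max P b -> in_max P (a + b).
Proof.
move=> PD [u uP ->] [v vP ->]; exists (fun i => u i + v i) => [i|]; first exact: PD.
by rewrite -big_split; apply: eq_bigr => i _; rewrite scalerDr.
Qed.

Lemma in_maxX (U : lmodType Q) (P : U -> Prop) i a :
  P 0 -> P a -> in_max P ('X_i *: a).
Proof.
move=> P0 Pa; exists (fun j => if j == i then a else 0) => [j|]; first by case: eqP.
rewrite (bigD1 i) //= eqxx big1 ?addr0 // => j /negPf->; exact: scaler0.
Qed.

End HomogeneousBases.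

(** * Monomial ideals as sets of exponents *)

Section MonomialIdeals.
Variables (k : fieldType) (n : nat).
Local Notation Q := {mpoly k[n]}.
Implicit Types (J : pred 'X_{1..n}) (p q : Q) (i : 'I_n).

(** The span of the monomials in [J], an ideal when [J] is a [monomial_ideal]. Sums and
    intersections of such ideals become disjunctions and conjunctions of predicates. *)
Definition mono_ideal J p : Prop := forall m, p@_m != 0 -> J m.

Definition monomial_ideal J := forall m m', J m -> J (m + m')%MM.

Lemma mono_ideal0 J : mono_ideal J 0.
Proof. by move=> m; rewrite mcoeff0 eqxx. Qed.

Lemma mono_idealD J p q : mono_ideal J p -> mono_ideal J q -> mono_ideal J (p + q).
Proof.
move=> Jp Jq m; rewrite mcoeffD.
by have [->|/Jp //] := eqVneq p@_m 0; rewrite add0r; apply: Jq.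
Qed.

Lemma mono_idealM J p q : monomial_ideal J -> mono_ideal J p -> mono_ideal J (q * p).
Proof.
move=> JM Jp m; rewrite -mcoeff_msupp mulrC.
move=> /msuppM_le/allpairsP[[m1 m2] /= [mp _ ->]].
by apply/JM/Jp; rewrite -mcoeff_msupp.
Qed.

Lemma mono_idealN J p : mono_ideal J p -> mono_ideal J (- p).
Proof. by move=> Jp m; rewrite mcoeffN oppr_eq0 => /Jp. Qed.

Lemma mono_ideal_sub J J' p :
  {subset J <= J'} -> mono_ideal J p -> mono_ideal J' p.
Proof. by move=> JJ' Jp m /Jp; apply: JJ'. Qed.

Lemma mono_ideal_mfilter J P p :
  mono_ideal J p -> mono_ideal (predI P J) (mfilter P p).
Proof.
move=> Jp m; rewrite mcoeff_mfilter; case: ifP => [Pm /Jp Jm|]; last by rewrite eqxx.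
exact/andP.
Qed.

Lemma mfilterK P p : mfilter P p + mfilter (predC P) p = p.
Proof.
apply/mpolyP=> m; rewrite mcoeffD !mcoeff_mfilter /=.
by case: (P m); rewrite ?addr0 ?add0r.
Qed.

Lemma mcoeffXM i p m : ('X_i * p)@_(U_(i) + m) = p@_m.
Proof. by rewrite mulrC mcoeffMX. Qed.

Lemma mono_idealXM i p : mono_ideal (fun m => 0 < m i)%N ('X_i * p).
Proof.
move=> m; rewrite -mcoeff_msupp.
move=> /msuppM_le/allpairsP[[m1 m2] /= []].
by rewrite msuppX inE => /eqP-> _ ->; rewrite mnmDE mnm1E eqxx.
Qed.

Lemma mono_ideal_divX i p : mono_ideal (fun m => 0 < m i)%N p ->
  exists q, p = 'X_i * q.
Proof.
move=> pP; exists (\sum_(m <- msupp p) p@_m *: 'X_[m - U_(i)]).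
rewrite {1}[p]mpolyE mulr_sumr; apply: eq_big_seq => m mp.
rewrite -scalerAr -mpolyXD addmC submK // lep1mP -lt0n.
by apply: pP; rewrite -mcoeff_msupp.
Qed.

(* Equivalently, ['X_i] is a nonzerodivisor modulo the ideal. *)
Definition avoids i J := forall m, J (U_(i) + m)%MM -> J m.

Lemma avoidsP i J p : avoids i J -> mono_ideal J ('X_i * p) -> mono_ideal J p.
Proof. by move=> iJ Jp m pm; apply/iJ/Jp; rewrite mcoeffXM. Qed.

Lemma monomial_graded_ideal J : monomial_ideal J -> graded_ideal (mono_ideal J).
Proof.
move=> JM; split; first exact: mono_ideal0.
- by move=> q p r Jp Jr; apply: mono_idealD => //; apply: mono_idealM.
- by move=> d p /mono_ideal_mfilter h; apply: mono_ideal_sub (h _) => m /andP[].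
Qed.

End MonomialIdeals.

(** * Minimal dg resolutions and the adjunction of a variable *)

Section DGResolutions.
Variables (k : fieldType) (n : nat).
Local Notation Q := {mpoly k[n]}.
Local Notation "a ** b" := (dg_mul a b) (at level 40, left associativity).

(** A minimal graded free resolution of the quotient of [Q] by the ideal of [J]. Degree 0 consists
    of scalars, so the augmentation is implicit and exactness there is the clause [dgr_ideal]. *)
Record dg_resolution (A : dga k n) (gr : nat -> A -> Prop)
    (J : pred 'X_{1..n}) : Prop := DGResolution {
  dgr_grading : dg_grading gr;
  dgr_scalar : forall a, gr 0%N a -> exists q, a = q *: dg_one A;
  dgr_exact : forall i a, gr i.+1 a -> dg_dif a = 0 ->
    exists2 b, gr i.+2 b & a = dg_dif b;
  dgr_ideal : forall q, mono_ideal J q <->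
    exists2 a, gr 1%N a & dg_dif a = q *: dg_one A;
  dgr_minimal : forall i a, gr i.+1 a -> in_max (gr i) (dg_dif a);
  dgr_free : forall i, hom_free (@dg_hom _ _ A) (gr i)
}.

Lemma dgr_scalarE (A : dga k n) gr J (a : A) :
  dg_resolution gr J -> gr 0%N a -> a = dg_eps a *: dg_one A.
Proof. by move=> rA /(dgr_scalar rA)[q ->]; rewrite dg_eps_scalar. Qed.

Lemma scalar_inj (A : dga k n) (p q : Q) :
  p *: dg_one A = q *: dg_one A -> p = q.
Proof. by move=> /(congr1 (@dg_eps _ _ A)); rewrite !dg_eps_scalar. Qed.

Lemma eq_dg_resolution (A : dga k n) (gr : nat -> A -> Prop) J J' :
  J =1 J' -> dg_resolution gr J -> dg_resolution gr J'.
Proof.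
move=> JJ' [gA sA eA iA mA fA]; split=> // q; apply: iff_trans (iA q).
by split=> h m /h; rewrite JJ'.
Qed.

Lemma hom_free0 (A : dga k n) : hom_free (@dg_hom _ _ A) (fun a => a = 0).
Proof.
exists void, (fun=> 0), (fun=> 0); split=> //; try by case.
move=> u ->; exists (fun=> 0); last by move=> ? ? [].
by rewrite big1 // => -[].
Qed.

Lemma hom_free_scalar (A : dga k n) :
  hom_free (@dg_hom _ _ A) (fun a => exists q, a = q *: dg_one A).
Proof.
have lA := dgaP A; exists unit, (fun=> 0), (fun=> dg_one A); split.
- by move=> _; exists 1; rewrite scale1r.
- by move=> _; apply: (dg_hom1 lA).
- move=> c; rewrite (big_pred1 tt) => [c0 []|[] //].
  by apply: (@scalar_inj A); rewrite c0 scale0r.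
- move=> _ [q ->]; exists (fun=> q); first by rewrite (big_pred1 tt) => [|[]].
  by move=> d /(dg_hom_eps lA); rewrite dg_eps_scalar subr0.
Qed.

Definition base_gr i (a : base_dga k n) : Prop := if i is 0%N then True else a = 0.

(** The start of the induction: while the graph has no vertex, both ideals are zero. *)
Lemma base_resolution : dg_resolution base_gr pred0.
Proof.
split.
- split.
  + by case.
  + by case=> // i q a b /= -> ->; rewrite scaler0 addr0.
  + by [].
  + case=> [|i] [|j] //= a b => [_ ->|-> _|-> _].
    * exact: mulr0.
    * exact: mul0r.
    * exact: mul0r.
  + by case.
  + by [].
  + by move=> [|i] a /= ga; rewrite ?ga ?scale1r ?scaler0.
  + by move=> i a /= ->; rewrite ?raddf0.
  + move=> [|i] j a b ga _; first by rewrite scale1r; apply: mulrC.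
    have [-> ->] : a ** b = 0 /\ b ** a = 0.
      by rewrite (ga : a = 0); split; [apply: mul0r | apply: mulr0].
    by rewrite scaler0.
  + by case=> // i a _ /= ->; apply: mulr0.
- by move=> a _; exists a; rewrite -[RHS]/(a * 1) mulr1.
- by move=> i a /= -> _; exists 0; rewrite ?raddf0.
- move=> q; split=> [q0 | [a _ qE]].
    exists 0; rewrite // raddf0 (_ : q = 0) ?scale0r //.
    by apply/mpolyP=> m; apply/eqP; rewrite mcoeff0; apply: contraT => /q0.
  rewrite (_ : q = 0); first exact: mono_ideal0.
  by rewrite -[q]mulr1; apply/esym/qE.
- move=> i a _; exists (fun=> 0); first by case: i.
  by rewrite big1 // => j _; rewrite scaler0.
- case=> [|i].
    apply: (eq_hom_free _ (hom_free_scalar (base_dga k n))) => a.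
    by split=> // _; exists a; apply/esym/mulr1.
  exact: hom_free0.
Qed.

Lemma hom_free_shift_gr (A : dga k n) gr J i :
  @dg_resolution A gr J -> hom_free (@dg_hom _ _ A) (shift_gr gr i).
Proof. by case: i => [_|i /dgr_free/(_ i)]; first exact: hom_free0. Qed.

Lemma hom_free_adjoin (A : dga k n) v (P P' : A -> Prop) : P 0 -> P' 0 ->
  hom_free (@dg_hom _ _ A) P -> hom_free (@dg_hom _ _ A) P' ->
  hom_free (@dg_hom _ _ (adjoin A v)) (fun u : adjoin A v => P u.1 /\ P' u.2).
Proof.
move=> P0 P'0; have lA := dgaP A.
apply: (hom_free_sum (f := fun a => (a, 0) : adjoin A v)
  (g := fun a => (0, a) : adjoin A v) (s := 0) (t := 1)) => //.
- by move=> q x y; congr (_, _) => /=; rewrite scaler0 addr0.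
- by move=> q x y; congr (_, _) => /=; rewrite scaler0 addr0.
- move=> [a b]; split=> [[/= Pa Pb] | [a' [b' [Pa Pb [-> ->]]]]].
    by exists a, b; split=> //; congr (_, _); rewrite /= ?addr0 ?add0r.
  by rewrite /= addr0 add0r.
- by move=> a b [/=]; rewrite addr0 add0r => -> ->.
- by move=> d a ha; rewrite addr0; split=> //; apply: dg_hom0.
- by move=> d a ha; split; rewrite /= ?addrK //; apply: dg_hom0.
- by move=> d a b [/=]; rewrite addr0 add0r subr0.
Qed.

(** As a complex, [A<e>] is the mapping cone of multiplication by ['X_v] on [A]; it is acyclic in
    positive degrees because ['X_v] is a nonzerodivisor modulo the ideal of [J]. *)
Lemma adjoin_resolution (A : dga k n) gr J v :
  avoids v J -> @dg_resolution A gr J ->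
  @dg_resolution (adjoin A v) (adjoin_gr gr (v := v)) (fun m => J m || (0 < m v)%N).
Proof.
move=> vJ rA; have gA := dgr_grading rA; have lA := dgaP A.
split; first exact: adjoin_grading.
- by move=> [a b] [/= /(dgr_scalar rA)[q ->] ->]; exists q; congr (_, _) => /=; rewrite scaler0.
- move=> i [a b] [/= ga gb] [da db].
  (* The coefficient [b] is a boundary. If it has degree 0, then ['X_v b = - da] lies in the ideal,
     hence so does [b]. *)
  have [c gc bE] : exists2 c, gr i.+1 c & b = dg_dif c.
    case: i ga gb => [|i] ga gb; last exact: (dgr_exact rA).
    have bE := dgr_scalarE rA gb.
    have /(avoidsP vJ)/(dgr_ideal rA)[c gc dc] : mono_ideal J ('X_v * dg_eps b).
      apply/(dgr_ideal rA); exists (- a); first exact: gr_N.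
      have := gr_par gA gb; rewrite scale1r => pb.
      rewrite -scalerA -bE raddfN /=; apply/eqP; rewrite eq_sym -addr_eq0 addrC.
      by move: da; rewrite pb => ->.
    by exists c => //; rewrite dc.
  (* Removing the boundary of [c e] from [a + b e] leaves a cycle of [A]. *)
  have [||e ge aE] := dgr_exact rA (a := a - 'X_v *: dg_par c) (i := i).
  + by apply: (gr_D gA) => //; apply/(gr_N gA)/(gr_Z gA)/(gr_parE gA).
  + rewrite raddfB /= linearZ /= (dg_dif_par lA) scalerN opprK -bE.
    exact: da.
  exists (e, c); first by [].
  by congr (_, _) => //=; rewrite -aE subrK.
- move=> q; split=> [Jq | [[a b] [/= ga gb] [dq _]] m].
    (* The monomials of [q] in [J] are reached from [A]; the others are divisible by ['X_v] and are
       reached from a multiple of [e]. *)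
    have /mono_ideal_divX[r rE] :
        mono_ideal (fun m => 0 < m v)%N (mfilter (predC J) q).
      apply: mono_ideal_sub (mono_ideal_mfilter Jq).
      by move=> m; rewrite !inE => /andP[/negPf->].
    have /(dgr_ideal rA)[a ga dq]: mono_ideal J (mfilter J q).
      by apply: mono_ideal_sub (mono_ideal_mfilter Jq) => m /andP[].
    exists (a, r *: dg_one A); first by split=> //=; apply/(gr_Z gA)/(gr_one gA).
    congr (_, _) => /=; last by rewrite linearZ /= dg_dif1 !scaler0.
    rewrite linearZ /= (dg_par1 lA) dq scalerA -scalerDl -rE.
    by rewrite mfilterK.
  have eda := dgr_scalarE rA (gr_dif gA ga).
  have Jda : mono_ideal J (dg_eps (dg_dif a)) by apply/(dgr_ideal rA); exists a.
  have := gr_par gA gb; rewrite scale1r => pb.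
  move: dq; rewrite pb eda [b](dgr_scalarE rA gb) scalerA -scalerDl.
  move=> /scalar_inj <-; rewrite mcoeffD.
  have [->|pm _] := eqVneq (dg_eps (dg_dif a))@_m 0; last by rewrite (Jda _ pm).
  by rewrite add0r => Xm; rewrite (@mono_idealXM _ _ v _ _ Xm) orbT.
- move=> i [a b] [/= ga gb].
  have aD := gr_D (adjoin_grading v gA).
  rewrite [X in in_max _ X](_ : _ = ((dg_dif a, 0) : adjoin A v)
    + 'X_v *: ((dg_par b, 0) : adjoin A v) + ((0, dg_dif b) : adjoin A v)); last first.
    by congr (_, _) => /=; rewrite ?scaler0 ?addr0 ?add0r.
  apply: in_maxD; [exact: aD | apply: in_maxD; [exact: aD | | ] | ].
  + apply: (in_max_map (f := fun a => (a, 0) : adjoin A v)) (dgr_minimal rA ga).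
      by move=> q x y; congr (_, _) => /=; rewrite scaler0 addr0.
    by move=> u gu; split=> //=; apply: shift_gr0.
  + apply: in_maxX; first exact: (gr_0 (adjoin_grading v gA)).
    by split; [apply: gr_parE | apply: shift_gr0].
  + case: i ga gb => [|i] ga gb.
      rewrite (gr_dif0 gA gb); exists (fun=> 0); first by move=> j; apply: (gr_0 (adjoin_grading v gA)).
      by rewrite big1 // => j _; rewrite scaler0.
    apply: (in_max_map (f := fun b => (0, b) : adjoin A v)) (dgr_minimal rA gb).
      by move=> q x y; congr (_, _) => /=; rewrite scaler0 addr0.
    by move=> u gu; split=> //=; apply: gr_0.
- move=> i; apply: (hom_free_adjoin v); last exact: hom_free_shift_gr rA.
  + exact: gr_0.
  + exact: shift_gr0.
  + exact: (dgr_free rA).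
Qed.

End DGResolutions.

(** * Dominating vertices: the fibre product *)

Section DGMaps.
Variables (k : fieldType) (n : nat).
Local Notation Q := {mpoly k[n]}.
Local Notation "a ** b" := (dg_mul a b) (at level 40, left associativity).

Record dga_map_laws (A B : dga k n) (f : A -> B) : Prop := DGAMapLaws {
  dgm_linear : linear f;
  dgm_one : f (dg_one A) = dg_one B;
  dgm_mul : forall a b, f (a ** b) = f a ** f b;
  dgm_par : forall a, f (dg_par a) = dg_par (f a);
  dgm_dif : forall a, f (dg_dif a) = dg_dif (f a);
  dgm_hom : forall d a, dg_hom d a -> dg_hom d (f a)
}.

Record dga_map (A B : dga k n) :=
  DGAMap { dgm_val :> A -> B; dgmP : dga_map_laws dgm_val }.

HB.instance Definition _ (A B : dga k n) (f : dga_map A B) :=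
  GRing.isLinear.Build Q A B *:%R f (dgm_linear (dgmP f)).

(** The second clause keeps the fibre product minimal, since [phi] enters its differential. *)
Definition graded_minimal_map (A B : dga k n) (grA : nat -> A -> Prop)
    (grB : nat -> B -> Prop) (f : A -> B) : Prop :=
  (forall i a, grA i a -> grB i (f a)) /\
  (forall i a, grA i.+1 a -> in_max (grB i.+1) (f a)).

Section Extension.
Variables (A K : dga k n) (phi : dga_map A K) (v : 'I_n).
Variables (grA : nat -> A -> Prop) (grK : nat -> K -> Prop).

(** The comparison map after an isolated vertex: [A] is unchanged and [K] is included in [K<e>]. *)
Definition adjoin_map (a : A) : adjoin K v := (phi a, 0).

Lemma adjoin_map_laws : dga_map_laws adjoin_map.
Proof.
have lf := dgmP phi; split.
- by move=> q a b; congr (_, _); rewrite /= ?scaler0 ?addr0 ?linearP.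
- by congr (_, _); apply: dgm_one.
- move=> a b; congr (_, _) => /=; first exact: dgm_mul.
  by rewrite raddf0 dg_mul0l addr0.
- by move=> a; congr (_, _) => /=; rewrite ?raddf0 ?(dgm_par lf).
- by move=> a; congr (_, _) => /=; rewrite ?raddf0 ?scaler0 ?addr0 ?(dgm_dif lf).
- by move=> d a ha; split; [apply: dgm_hom lf _ _ _ | apply: dg_hom0 (dgaP K) _].
Qed.

Lemma adjoin_map_minimal : dg_grading grK ->
  graded_minimal_map grA grK phi ->
  graded_minimal_map grA (adjoin_gr grK (v := v)) adjoin_map.
Proof.
move=> gK [phi_gr phi_max]; split=> [i a ga | i a /phi_max].
  by split=> /=; [apply: phi_gr | apply: shift_gr0].
apply: (in_max_map (f := fun b => (b, 0) : adjoin K v)).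
  by move=> q x y; congr (_, _) => /=; rewrite scaler0 addr0.
by move=> b gb; split=> //=; apply: gr_0.
Qed.

(* The algebra of a dominating vertex ['X_v]: the fibre product of [A<e>] and
   [K] over [K / 'X_v K], truncated so that it is reduced to the scalars in
   degree [0].  Its elements of positive degree are the [fib ((a, a'), b)]. *)
Definition fiber := dprod (adjoin A v) K.

(** The condition that the components agree modulo ['X_v] is solved by [phi a + 'X_v b]. On graded
    [b] the correction [dg_eps (dg_dif b)] can be nonzero only in degree 1, where it is the one
    coefficient of [e] giving both components the same scalar differential. *)
Definition fib (t : fiber) : fiber :=
  ((t.1.1, t.1.2 + dg_eps (dg_dif t.2) *: dg_one A), phi t.1.1 + 'X_v *: t.2).

(** Parameters of the elements of degree [i.+1]. For [i = 0] the entry [a'] is 0, because [b]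
    already determines the coefficient of [e]. *)
Definition fib_source i (t : fiber) : Prop :=
  [/\ grA i.+1 t.1.1, shift_gr (fun j => grA j.+1) i t.1.2 & grK i.+1 t.2].

Definition fiber_gr i (u : fiber) : Prop :=
  if i is j.+1 then exists2 t, fib_source j t & u = fib t
  else exists q, u = q *: dg_one fiber.

Lemma fib_linear : linear fib.
Proof.
move=> q [[a a'] b] [[c c'] f]; rewrite /fib /=.
congr ((_, _), _) => /=.
  by rewrite [dg_dif _]linearP raddfD /= dg_epsZ scalerDl -scalerA scalerDr addrACA.
by rewrite linearP !scalerDr !scalerA mulrC addrACA.
Qed.

HB.instance Definition _ := GRing.isLinear.Build Q fiber fiber *:%R fib fib_linear.

Variables (J J' : pred 'X_{1..n}).
Hypotheses (rA : dg_resolution grA J) (rK : dg_resolution grK J').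
Hypothesis phiP : graded_minimal_map grA grK phi.

Let gA := dgr_grading rA.
Let gK := dgr_grading rK.
Let lA := dgaP A.
Let lK := dgaP K.
Let lphi := dgmP phi.

Lemma fib_source0 i : fib_source i 0.
Proof.
split; [exact: (gr_0 gA) | | exact: (gr_0 gK)].
by case: i => //= i; apply: (gr_0 gA).
Qed.

Lemma fib_source_lin i q t t' :
  fib_source i t -> fib_source i t' -> fib_source i (q *: t + t').
Proof.
move=> [ga ga' gb] [gc gc' gf]; split; [exact: (gr_lin gA) | | exact: (gr_lin gK)].
case: i ga' gc' {ga gb gc gf} => [|i] /= ga' gc'; last exact: (gr_lin gA).
by rewrite ga' gc' scaler0 addr0.
Qed.

Lemma gr_dif_eps (B : dga k n) gr i (b : B) :
  dg_grading gr -> gr i.+2 b -> dg_eps (dg_dif b) = 0.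
Proof. by move=> gB /(gr_dif gB)/(gr_eps gB). Qed.

Lemma dgr_scalar_dif (B : dga k n) gr J0 (b : B) :
  dg_resolution gr J0 -> gr 1%N b -> dg_dif b = dg_eps (dg_dif b) *: dg_one B.
Proof. by move=> rB gb; apply/(dgr_scalarE rB)/(gr_dif (dgr_grading rB)). Qed.

Lemma fib_source_eps i t : fib_source i t ->
  grA i (t.1.2 + dg_eps (dg_dif t.2) *: dg_one A).
Proof.
case: i => [|i] [_ /= ga' gb].
  by rewrite ga' add0r; apply/(gr_Z gA)/(gr_one gA).
by rewrite (gr_dif_eps gK gb) scale0r addr0.
Qed.

Lemma fib_gr i t : fib_source i t ->
  dprod_gr (adjoin_gr grA (v := v)) grK i.+1 (fib t).
Proof.
move=> tP; have [ga ga' gb] := tP; split; last first.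
  by apply: (gr_D gK); [apply: (proj1 phiP) | apply: (gr_Z gK)].
by split=> //=; apply: fib_source_eps.
Qed.

Let gP := dprod_grading (adjoin_grading v gA) gK.

Lemma fiber_gr_sub i u : fiber_gr i u ->
  dprod_gr (adjoin_gr grA (v := v)) grK i u.
Proof.
case: i => [[q ->] | i [t tP ->]]; last exact: fib_gr.
exact/(gr_Z gP)/(gr_one gP).
Qed.

Lemma fib_mul i j t t' : fib_source i t -> fib_source j t' ->
  exists2 t'', fib_source (i + j).+1 t'' & fib t ** fib t' = fib t''.
Proof.
move=> tP t'P; have [ga ga' gb] := tP; have [gc gc' gf] := t'P.
(* The last entry is the cofactor of ['X_v] in the product of the two [K]-components. The product
   has degree at least 2, where the correction term of [fib] vanishes. *)
pose t'' : fiber := ((t.1.1 ** t'.1.1,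
    t.1.1 ** (t'.1.2 + dg_eps (dg_dif t'.2) *: dg_one A)
      + (t.1.2 + dg_eps (dg_dif t.2) *: dg_one A) ** dg_par t'.1.1),
  phi t.1.1 ** t'.2 + t.2 ** phi t'.1.1 + 'X_v *: (t.2 ** t'.2)).
have t''P : fib_source (i + j).+1 t''.
  have ij : (i + j).+2 = (i.+1 + j.+1)%N by rewrite addSn addnS.
  have [phi_gr _] := phiP.
  split=> /=.
  - by rewrite ij; apply: (gr_mul gA).
  - apply: (gr_D gA); last rewrite -addnS.
      by rewrite -addSn; apply: (gr_mul gA) => //; apply: fib_source_eps.
    by apply: (gr_mul gA); [apply: fib_source_eps | apply: (gr_parE gA)].
  - rewrite ij; apply: (gr_D gK); first apply: (gr_D gK).
    + by apply: (gr_mul gK) => //; apply: phi_gr.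
    + by apply: (gr_mul gK) => //; apply: phi_gr.
    + by apply/(gr_Z gK)/(gr_mul gK).
exists t'' => //; have [_ _ gt''] := t''P.
congr ((_, _), _); first by rewrite (gr_dif_eps gK gt'') scale0r addr0.
rewrite /= (dgm_mul lphi) dg_mulDl !raddfD /= !linearZ /= !dg_mulZl.
by rewrite -!addrA linearZ.
Qed.

(** The differential in terms of parameters. The first entry gains ['X_v *: dg_par a'], whose image
    under [phi] is compensated in the last. For [i = 0] the result has degree 1 and [da'] reappears
    as the correction term of [fib]. *)
Definition fib_bd i (t : fiber) : fiber :=
  ((dg_dif t.1.1 + 'X_v *: dg_par t.1.2, if i is 0 then 0 else dg_dif t.1.2),
   dg_dif t.2 - phi (dg_par t.1.2)).

Lemma fib_bd_source i t : fib_source i.+1 t -> fib_source i (fib_bd i t).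
Proof.
move=> [ga ga' gb]; split=> /=.
- by apply: (gr_D gA); [apply: (gr_dif gA) | apply/(gr_Z gA)/(gr_parE gA)].
- by case: i ga' {ga gb} => //= i /(gr_dif gA).
- apply: (gr_D gK); first exact: (gr_dif gK).
  by apply/(gr_N gK)/(proj1 phiP)/(gr_parE gA).
Qed.

Lemma fib_dif i t : fib_source i.+1 t -> dg_dif (fib t) = fib (fib_bd i t).
Proof.
move=> [ga ga' gb]; rewrite /fib; congr ((_, _), _) => /=.
- by rewrite (gr_dif_eps gK gb) scale0r addr0.
- rewrite (gr_dif_eps gK gb) scale0r addr0 raddfB /= (dg_difK lK) sub0r.
  rewrite -(dgm_dif lphi) (dg_dif_par lA) [phi (- _)]raddfN opprK /=.
  case: i ga' {ga gb} => [|i] ga'; last first.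
    have /(gr_eps gK) -> : grK i.+1 (phi (dg_par (dg_dif t.1.2))).
      by apply/(proj1 phiP)/(gr_parE gA)/(gr_dif gA).
    by rewrite scale0r addr0.
  have -> : phi (dg_par (dg_dif t.1.2)) = dg_eps (dg_dif t.1.2) *: dg_one K.
    rewrite {1}(dgr_scalar_dif rA ga') !linearZ /=.
    by rewrite (dg_par1 lA) (dgm_one lphi).
  by rewrite add0r dg_eps_scalar -(dgr_scalar_dif rA ga').
- rewrite !raddfD /= !linearZ /= (dgm_dif lphi) raddfN /=.
  by rewrite -addrA [X in _ = _ + X]addrC subrK.
Qed.

Lemma fib_dif0 t : fib_source 0 t -> dg_dif (fib t)
  = (dg_eps (dg_dif t.1.1) + 'X_v * dg_eps (dg_dif t.2)) *: dg_one fiber.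
Proof.
move=> [ga /= a'0 gb]; congr ((_, _), _); rewrite /= ?a'0.
- rewrite add0r scalerDl -(dgr_scalar_dif rA ga) linearZ /= (dg_par1 lA).
  by rewrite scalerA.
- by rewrite add0r linearZ /= dg_dif1 !scaler0.
- rewrite raddfD /= linearZ /= -(dgm_dif lphi) [in LHS](dgr_scalar_dif rA ga).
  rewrite [in LHS](dgr_scalar_dif rK gb) linearZ /= (dgm_one lphi) scalerA.
  by rewrite -scalerDl.
Qed.

Lemma fib_inj t : fib t = 0 -> t = 0.
Proof.
case: t => -[a a'] b [/= a0 + +]; rewrite a0 raddf0 add0r => a'0.
move=> /(dg_torsion_free lK) b0; move: a'0; rewrite b0 !raddf0 scale0r addr0.
by move->.
Qed.

Lemma fiber_grading : dg_grading fiber_gr.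
Proof.
split.
- case=> [|i]; first by exists 0; rewrite scale0r.
  by exists 0; [apply: fib_source0 | rewrite raddf0].
- move=> [|i] q a b => [[p ->] [r ->]|[t tP ->] [t' t'P ->]].
    by exists (q * p + r); rewrite scalerDl scalerA.
  by exists (q *: t + t'); [apply: fib_source_lin | rewrite linearP].
- by exists 1; rewrite scale1r.
- have scal i q t : fib_source i t -> fib_source i (q *: t).
    move=> tP; rewrite -[q *: t]addr0; apply: fib_source_lin => //.
    exact: fib_source0.
  have lF := dgaP fiber.
  move=> [|i] [|j] u w => [[q ->] [r ->]|[q ->] [t tP ->]|[t tP ->] [q ->]|].
  + by exists (q * r); rewrite dg_mulZl (dg_mul1l lF) scalerA.
  + exists (q *: t); first exact: scal.
    by rewrite dg_mulZl (dg_mul1l lF) linearZ.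
  + rewrite addn0; exists (q *: t); first exact: scal.
    have -> : fib (q *: t) = q *: fib t by apply: linearZ.
    by rewrite -[in RHS](dg_mul1r lF (fib t)); apply: linearZ.
  + move=> [t tP ->] [t' t'P ->]; rewrite addSn addnS.
    have [t'' t''P ->] := fib_mul tP t'P.
    by exists t''.
- move=> [|i] u [t tP ->]; first by rewrite (fib_dif0 tP); eexists.
  by rewrite (fib_dif tP); exists (fib_bd i t); first exact: fib_bd_source.
- move=> u [q ->]; transitivity (q *: dg_dif (dg_one fiber)); first exact: linearZ.
  by rewrite dg_dif1 scaler0.
- by move=> i u /fiber_gr_sub/(gr_par gP).
- by move=> i u /fiber_gr_sub/(gr_eps gP).
- by move=> i j u w /fiber_gr_sub gu /fiber_gr_sub; apply: (gr_comm gP).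
- by move=> i u oi /fiber_gr_sub; apply: (gr_sq gP).
Qed.

Hypotheses (JJ' : {subset J <= J'}) (J'M : monomial_ideal J').
Hypotheses (vJ : avoids v J) (vJ' : avoids v J').

(** As [J] is contained in [J'] and ['X_v] is a nonzerodivisor modulo [J'], the intersection of [J']
    with [J + ('X_v)] is [J + 'X_v J']. The summands are reached from [A] and [K] respectively. *)
Lemma fiber_scalar_dif (q : Q) :
  mono_ideal (fun m => J' m && (J m || (0 < m v)%N)) q <->
  exists2 t, fib_source 0 t
    & q = dg_eps (dg_dif t.1.1) + 'X_v * dg_eps (dg_dif t.2).
Proof.
split=> [Jq | [[[a a'] b] [/= ga _ gb] ->]].
  have /mono_ideal_divX[r rE] :
      mono_ideal (fun m => 0 < m v)%N (mfilter (predC J) q).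
    apply: mono_ideal_sub (mono_ideal_mfilter Jq).
    by move=> m; rewrite !inE => /and3P[/negPf->].
  have /(dgr_ideal rA)[a ga aE] : mono_ideal J (mfilter J q).
    by apply: mono_ideal_sub (mono_ideal_mfilter Jq) => m /andP[].
  have /(avoidsP vJ')/(dgr_ideal rK)[b gb bE] : mono_ideal J' ('X_v * r).
    rewrite -rE; apply: mono_ideal_sub (mono_ideal_mfilter Jq).
    by move=> m /and3P[].
  exists ((a, 0), b) => //=.
  by rewrite aE bE !dg_eps_scalar -rE mfilterK.
have Ja : mono_ideal J (dg_eps (dg_dif a)).
  by apply/(dgr_ideal rA); exists a => //; apply: (dgr_scalar_dif rA).
have Jb : mono_ideal J' (dg_eps (dg_dif b)).
  by apply/(dgr_ideal rK); exists b => //; apply: (dgr_scalar_dif rK).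
apply: mono_idealD => [m /Ja Jm | m Xm].
  by rewrite Jm andbT; apply: JJ'.
by rewrite (mono_idealM J'M Jb Xm) (@mono_idealXM _ _ v _ _ Xm) orbT.
Qed.

(** Some [c] bounds the coefficient of [e]; correcting the first parameter by ['X_v par(c)] and the
    last by [phi (par c)] leaves cycles of [A] and [K], where exactness is known. *)
Lemma fib_exact i t : fib_source i t -> dg_dif (fib t) = 0 ->
  exists2 u, fib_source i.+1 u & fib t = dg_dif (fib u).
Proof.
move=> tP; have [ga ga' gb] := tP.
move=> dt0; have [c [gc cA cK cE]] : exists c, [/\ grA i.+1 c,
    dg_dif t.1.1 + 'X_v *: dg_par (dg_dif c) = 0,
    dg_dif t.2 = phi (dg_par (dg_dif c))
  & t.1.2 = if i is 0 then 0 else dg_dif c].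
  case: i => [|i] in tP ga ga' gb *.
    move: dt0; rewrite (fib_dif0 tP) -(scale0r (dg_one fiber)).
    move=> /scalar_inj /eqP; rewrite addr_eq0 => /eqP dE.
    (* In degree 1, [da = - 'X_v db] lies in the ideal of [J], hence so does the scalar [db], which
       is therefore the differential of some [c]. *)
    have /(avoidsP vJ)/(dgr_ideal rA)[c gc cE] : mono_ideal J ('X_v * dg_eps (dg_dif t.2)).
      rewrite -[X in mono_ideal _ X]opprK -dE; apply: mono_idealN.
      by apply/(dgr_ideal rA); exists t.1.1 => //; apply: (dgr_scalar_dif rA).
    exists c; split=> //; rewrite cE linearZ /= (dg_par1 lA).
      by rewrite (dgr_scalar_dif rA ga) dE scalerA -scalerDl addNr scale0r.
    by rewrite linearZ /= (dgm_one lphi) -(dgr_scalar_dif rK gb).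
  case: dt0 => /=; rewrite (gr_dif_eps gK gb) scale0r addr0 => dA dA' dK.
  have [c gc cE] := dgr_exact rA ga' dA'; exists c; split=> //.
    by rewrite -cE.
  (* After multiplication by ['X_v] this identity in [K] becomes the vanishing of the last component
     of the differential. *)
  apply/eqP; rewrite -cE -subr_eq0; apply/eqP/(dg_torsion_free lK (i := v)).
  rewrite scalerBr -[X in _ - X]linearZ /=; have -> : 'X_v *: dg_par t.1.2 = - dg_dif t.1.1.
    by apply/eqP; rewrite -addr_eq0 addrC dA.
  by rewrite raddfN opprK addrC -[X in _ + X]linearZ /= (dgm_dif lphi) -raddfD.
have [||e ge eE] := dgr_exact rA (i := i) (a := t.1.1 - 'X_v *: dg_par c).
- by apply: (gr_D gA) => //; apply/(gr_N gA)/(gr_Z gA)/(gr_parE gA).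
- by rewrite raddfB /= linearZ /= (dg_dif_par lA) scalerN opprK.
have [||f gf fE] := dgr_exact rK (i := i) (a := t.2 + phi (dg_par c)).
- by apply: (gr_D gK) => //; apply/(proj1 phiP)/(gr_parE gA).
- by rewrite raddfD /= -(dgm_dif lphi) (dg_dif_par lA) raddfN cK subrr.
have uP : fib_source i.+1 (((e, c), f) : fiber) by [].
exists ((e, c), f) => //; rewrite (fib_dif uP); congr fib.
case: t {tP ga ga' gb dt0 cA cK uP} => -[a a'] b in cE eE fE *.
by congr ((_, _), _) => /=; rewrite -?eE -?fE ?subrK ?addrK.
Qed.

(** Lets homogeneous bases pass through [fib]. The degree of [b] is recovered from that of ['X_v b]
    by division. *)
Lemma fib_hom d (t : fiber) :
  dg_hom d (fib t) <-> dg_hom d t.1 /\ dg_hom (d - 1) t.2.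
Proof.
case: t => -[a a'] b.
have eps_hom : dg_hom (d - 1) b ->
    dg_hom (d - 1) (dg_eps (dg_dif b) *: dg_one A).
  move=> /(dg_hom_dif lK)/(dg_hom_eps lK) hb; rewrite -[d - 1]addr0.
  by apply: (dg_homZ lA) => //; apply: (dg_hom1 lA).
split=> [[[/= ha ha'] hb] | [[/= ha ha'] hb]].
  have {}hb : dg_hom (d - 1) b.
    apply: (dg_hom_divX lK (i := v)); rewrite -(addKr (phi a) (_ *: b)).
    by apply: (dg_homD lK) => //; apply/dg_homN/(dgm_hom lphi).
  do !split=> //=; rewrite -(addrK (dg_eps (dg_dif b) *: dg_one A) a').
  by apply: (dg_homD lA) => //; apply/dg_homN/eps_hom.
do !split=> //=; first by apply: (dg_homD lA) => //; apply: eps_hom.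
apply: (dg_homD lK); first exact: (dgm_hom lphi).
by rewrite -[d](subrK 1) addrC; apply: (dg_homZ lK) => //; apply: homogX.
Qed.

(** Each term is handled separately, by minimality of [A] or of [K], by its factor ['X_v], or, for
    [phi (par a')], by minimality of [phi]. *)
Lemma fib_bd_max i t : fib_source i.+1 t -> in_max (fib_source i) (fib_bd i t).
Proof.
move=> [ga /= ga' gb].
have sD u w : fib_source i u -> fib_source i w -> fib_source i (u + w).
  by rewrite -[u in X in _ -> _ -> X]scale1r; apply: fib_source_lin.
have [s0 s1 s2] := fib_source0 i.
pose ia (a : A) : fiber := ((a, 0), 0).
pose ia' (a : A) : fiber := ((0, a), 0).
pose ib (b : K) : fiber := (0, b).
have li : linear ia by move=> q x y; congr ((_, _), _) => /=; rewrite scaler0 addr0.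
have li' : linear ia' by move=> q x y; congr ((_, _), _) => /=; rewrite scaler0 addr0.
have lib : linear ib by move=> q x y; congr ((_, _), _) => /=; rewrite scaler0 addr0.
rewrite [fib_bd _ _](_ : _ = ia (dg_dif t.1.1) + 'X_v *: ia (dg_par t.1.2)
    + ia' (if i is 0 then 0 else dg_dif t.1.2) + ib (dg_dif t.2)
    + ib (- phi (dg_par t.1.2))); last first.
  by congr ((_, _), _) => /=; rewrite ?scaler0 ?addr0 ?add0r.
do 4?[apply: in_maxD; first exact: sD].
- apply: (in_max_map li _ (dgr_minimal rA ga)) => a pa; by split.
- apply: in_maxX; first exact: fib_source0.
  by split=> //; apply: (gr_parE gA).
- case: i ga' {ga gb sD s0 s2} s1 => [|i] ga' s1.
    exists (fun=> 0) => [_|]; first exact: fib_source0.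
    by rewrite big1 // => j _; rewrite scaler0.
  by apply: (in_max_map li' _ (dgr_minimal rA ga')) => a pa; split=> //; apply: gr_0.
- by apply: (in_max_map lib _ (dgr_minimal rK gb)) => b pb; split.
- have := proj2 phiP _ _ (gr_parE gA ga').
  apply: (in_max_map (f := fun b => ib (- b))).
    by move=> q x y; rewrite opprD -scalerN lib.
  by move=> b pb; split=> //; apply: (gr_N gK).
Qed.

Lemma fiber_resolution :
  dg_resolution fiber_gr (fun m => J' m && (J m || (0 < m v)%N)).
Proof.
split; first exact: fiber_grading.
- by [].
- move=> i _ [t tP ->] /(fib_exact tP)[u uP uE]; exists (fib u) => //.
  by exists u.
- move=> q; apply: iff_trans (fiber_scalar_dif q) _; split=> [[t tP ->] | [_ [t tP ->]]].
    by exists (fib t); [exists t | apply: fib_dif0].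
  by rewrite (fib_dif0 tP) => /scalar_inj <-; exists t.
- move=> [|i] _ [t tP ->]; last first.
    rewrite (fib_dif tP); apply: (in_max_map fib_linear _ (fib_bd_max tP)) => u uP.
    by exists u.
  have gF := fiber_grading.
  rewrite (fib_dif0 tP) scalerDl -scalerA; have [ga _ gb] := tP.
  apply: in_maxD; first exact: (gr_D gF).
    apply: (in_max_map (f := fun a => dg_eps a *: dg_one fiber)) (dgr_minimal rA ga).
      by move=> q x y; rewrite raddfD /= dg_epsZ scalerDl scalerA.
    by move=> a _; exists (dg_eps a).
  by apply: in_maxX; [apply: (gr_0 gF) | exists (dg_eps (dg_dif t.2))].
- case=> [|i]; first exact: hom_free_scalar.
  (* In positive degree [fib] is an isomorphism from its parameters, whose module splits into a part
     over [A<e>] and a part over [K]. *)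
  have fibE (u : adjoin A v) (b : K) : fib (u, b) = fib (u, 0) + fib (0, b).
    by rewrite -[RHS]raddfD; congr (fib (_, _)); rewrite ?addr0 ?add0r.
  have free0 : hom_free (@dg_hom _ _ A) (shift_gr (fun j => grA j.+1) i).
    by case: i => [|i]; [apply: hom_free0 | apply: (dgr_free rA)].
  have [s0 s1 s2] := fib_source0 i.
  have freeA := hom_free_adjoin v s0 s1 (dgr_free rA i.+1) free0.
  apply: (hom_free_sum (f := fun u => fib (u, 0)) (g := fun b => fib (0, b))
    (s := 0) (t := 1) _ _ _ _ _ _ _ _ _ freeA (dgr_free rK i.+1)).
  + move=> q x y; rewrite -[RHS]fib_linear; congr (fib (_, _)).
    by rewrite /= scaler0 addr0.
  + move=> q x y; rewrite -[RHS]fib_linear; congr (fib (_, _)).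
    by rewrite /= scaler0 addr0.
  + by [].
  + by [].
  + move=> w; split=> [[[u b] [ga ga' gb] ->] | [u [b [[ga ga'] gb ->]]]].
      by exists u, b; rewrite -fibE.
    by exists (u, b); rewrite -?fibE.
  + by move=> u b; rewrite -fibE => /fib_inj[-> ->].
  + move=> d u hu; rewrite addr0; apply/fib_hom; split=> //=.
    exact: (dg_hom0 lK).
  + move=> d b hb; apply/fib_hom; rewrite addrK; split=> //=.
    exact: (dg_hom0 (dgaP (adjoin A v))).
  + by move=> d u b; rewrite -fibE subr0 => /fib_hom.
Qed.

(** The comparison map after a dominating vertex: projection to [A<e>], then [phi] on both
    coefficients. *)
Definition fiber_map (u : fiber) : adjoin K v := (phi u.1.1, phi u.1.2).

Lemma fiber_map_laws : dga_map_laws fiber_map.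
Proof.
split.
- by move=> q [[a a'] b] [[c c'] f]; congr (_, _) => /=; rewrite linearP.
- by congr (_, _); [apply: dgm_one | apply: raddf0].
- move=> [[a a'] b] [[c c'] f]; congr (_, _) => /=; first exact: dgm_mul.
  by rewrite raddfD /= !(dgm_mul lphi) (dgm_par lphi).
- move=> [[a a'] b]; congr (_, _) => /=; first exact: dgm_par.
  by rewrite raddfN /= (dgm_par lphi).
- move=> [[a a'] b]; congr (_, _) => /=; last exact: dgm_dif.
  by rewrite raddfD /= linearZ /= (dgm_dif lphi) (dgm_par lphi).
- by move=> d [[a a'] b] [[/= ha ha'] _]; split; apply: (dgm_hom lphi).
Qed.

(** The delicate case is degree 1: thanks to the truncation, the coefficient of [e] is there the
    scalar [db], which lies in the maximal ideal by minimality of [K]. *)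
Lemma fiber_map_minimal :
  graded_minimal_map fiber_gr (adjoin_gr grK (v := v)) fiber_map.
Proof.
have [phi_gr phi_max] := phiP; split=> [i u /fiber_gr_sub[[ga ga'] _] | i _ [t tP ->]].
  split; first exact: phi_gr.
  by case: i ga' {ga} => [|i] /= => [->|/phi_gr//]; rewrite raddf0.
have [ga ga' gb] := tP; have gaK := adjoin_grading v gK.
rewrite [fiber_map _](_ : _ = ((phi t.1.1, 0) : adjoin K v)
    + ((0, phi t.1.2) : adjoin K v)
    + ((0, dg_eps (dg_dif t.2) *: dg_one K) : adjoin K v)); last first.
  congr (_, _) => /=; rewrite ?addr0 // add0r raddfD /= linearZ /=.
  by rewrite (dgm_one lphi).
have l1 : linear (fun b : K => (b, 0) : adjoin K v).
  by move=> q x y; congr (_, _) => /=; rewrite scaler0 addr0.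
have l2 : linear (fun b : K => (0, b) : adjoin K v).
  by move=> q x y; congr (_, _) => /=; rewrite scaler0 addr0.
have max0 : in_max (adjoin_gr grK (v := v) i.+1) 0.
  exists (fun=> 0) => [_|]; first exact: (gr_0 gaK).
  by rewrite big1 // => j _; rewrite scaler0.
do 2?[apply: in_maxD; first exact: (gr_D gaK)].
- apply: (in_max_map l1 _ (phi_max _ _ ga)) => b gb'.
  by split=> //; apply: (gr_0 gK).
- case: i ga' {tP ga gb} max0 => [|i] ga' max0.
    by rewrite (ga' : _ = 0) raddf0.
  apply: (in_max_map l2 _ (phi_max _ _ ga')) => b gb'.
  by split=> //; apply: (gr_0 gK).
- case: i gb {tP ga ga'} max0 => [|i] gb max0; last first.
    by rewrite (gr_dif_eps gK gb) scale0r.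
  rewrite -(dgr_scalar_dif rK gb).
  apply: (in_max_map l2 _ (dgr_minimal rK gb)) => b gb'.
  by split=> //; apply: (gr_0 gK).
Qed.

End Extension.
End DGMaps.

(** * Transfer to a given minimal resolution *)

Section Transfer.
Variables (k : fieldType) (n : nat).
Local Notation Q := {mpoly k[n]}.
Local Notation "a ** b" := (dg_mul a b) (at level 40, left associativity).
Variables (A : dga k n) (gr : nat -> A -> Prop) (J : pred 'X_{1..n}).
Hypotheses (rA : dg_resolution gr J) (JM : monomial_ideal J).

Let gA := dgr_grading rA.
Let lA := dgaP A.

(** An isomorphism of complexes from [F] onto the pieces [gr i], written as injections into their
    common carrier. *)
Definition graded_embedding (F : gfcomplex k n)
    (f : forall i, fmod F i -> A) : Prop :=
  [/\ forall i, linear (f i), forall i, injective (f i),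
      forall i x, gr i (f i x), forall i a, gr i a -> exists x, f i x = a
    & forall i (x : fmod F i.+1), f i (bd x) = dg_dif (f i.+1 x)].

(** Rank, degrees and basis are packed in one dependent pair, so that a single choice provides them
    in all degrees. *)
Lemma hom_basis_ord i : exists b : {r : nat & (('I_r -> int) * ('I_r -> A))%type},
  hom_basis (@dg_hom _ _ A) (gr i) (tagged b).1 (tagged b).2.
Proof.
have [X [s [e [Pe He fe ge]]]] := dgr_free rA i.
exists (Tagged (fun r => (('I_r -> int) * ('I_r -> A))%type)
  (s \o @enum_val X X, e \o @enum_val X X)).
have reind (c : X -> Q) :
    \sum_x c x *: e x = \sum_(j < #|X|) c (enum_val j) *: e (enum_val j).
  exact: (reindex _ (onW_bij _ (@enum_val_bij X))).
split=> //= [c c0 j|a /ge[c aE cH]].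
  rewrite -(enum_valK j); apply: (fe (c \o enum_rank)); rewrite reind -[RHS]c0.
  by apply: eq_bigr => l _; rewrite /= enum_valK.
exists (c \o enum_val); first by rewrite aE reind.
by move=> d /cH h j; apply: h.
Qed.

Lemma dg_resolution_gfcomplex : exists (M : gfcomplex k n)
    (f : forall i, fmod M i -> A),
  [/\ graded_embedding f, resolves M (mono_ideal J) & minimal M].
Proof.
have b i := constructive_indefinite_description _ (hom_basis_ord i).
pose r i := tag (sval (b i)).
pose s i : 'I_(r i) -> int := (tagged (sval (b i))).1.
pose e i : 'I_(r i) -> A := (tagged (sval (b i))).2.
have bP i : hom_basis (@dg_hom _ _ A) (gr i) (@s i) (@e i) := svalP (b i).
pose f i (x : 'rV[Q]_(r i)) : A := \sum_j x ord0 j *: e i j.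
have f_lin i : linear (f i).
  move=> q x y; rewrite /f scaler_sumr -big_split; apply: eq_bigr => j _.
  by rewrite !mxE scalerDl scalerA.
have f0 i := linear_at0 (f_lin i).
have f_inj i : injective (f i).
  move=> x y xy; apply/eqP; rewrite -subr_eq0; apply/eqP/rowP=> j.
  have [_ _ fe _] := bP i; rewrite [RHS]mxE.
  apply: (fe (fun j => (x - y) ord0 j)).
  by rewrite -/(f i (x - y)) addrC -scaleN1r f_lin xy scaleN1r addNr.
have f_gr i x : gr i (f i x).
  have [ge _ _ _] := bP i; rewrite /f; elim/big_ind: _ => [|a c|j _].
  - exact: gr_0.
  - exact: (gr_D gA).
  - exact: (gr_Z gA).
have f_surj i a : gr i a -> exists x, f i x = a.
  have [_ _ _ ge] := bP i; move=> /ge[c -> _]; exists (\row_j c j).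
  by apply: eq_bigr => j _; rewrite mxE.
have D_ex i : exists D : 'M[Q]_(r i.+1, r i), homog_mx (@s i.+1) (@s i) D /\
    forall j, f i (row j D) = dg_dif (e i.+1 j).
  have [ge he _ _] := bP i.+1; have [_ _ _ ge'] := bP i.
  have /fin_all_exists2[c cE ch] j := ge' _ (gr_dif gA (ge j)).
  exists (\matrix_(j, l) c j l); split=> [j l | j].
    by rewrite mxE; apply/ch/(dg_hom_dif lA).
  by rewrite cE; apply: eq_bigr => l _; rewrite !mxE.
have D i := constructive_indefinite_description _ (D_ex i).
have f_dif i (x : 'rV[Q]_(r i.+1)) : f i (x *m sval (D i)) = dg_dif (f i.+1 x).
  rewrite mulmx_sum_row /f [in RHS]linear_sum -/(f i _).
  have [_ DE] := svalP (D i).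
  rewrite (linear_comb _ _ (f_lin i)); apply: eq_bigr => j _.
  by rewrite DE linearZ.
have DD i : sval (D i.+1) *m sval (D i) = 0.
  apply/row_matrixP=> j; rewrite row_mul row0; apply: f_inj.
  have [_ DE] := svalP (D i.+1).
  by rewrite f_dif DE (dg_difK lA) f0.
pose M := GFComplex (fun i => proj1 (svalP (D i))) DD.
have augE x : (x *m (\col_j dg_eps (e 0%N j))) ord0 ord0 = dg_eps (f 0%N x).
  rewrite mxE /f linear_sum; apply: eq_bigr => j _.
  by rewrite mxE [RHS]dg_epsZ.
exists M, f; split.
- by split.
- exists (\col_j dg_eps (e 0%N j)); split.
  + move=> j; rewrite mxE; apply: (dg_hom_eps lA).
    by have [_ he _ _] := bP 0%N; apply: he.
  + move=> q; have [x xE] := f_surj 0%N _ (gr_Z gA q (gr_one gA)).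
    by exists x; rewrite augE xE dg_eps_scalar subrr; apply: mono_ideal0.
  + move=> x; rewrite augE; apply: iff_trans (dgr_ideal rA _) _.
    rewrite -(dgr_scalarE rA (f_gr 0%N x)).
    split=> [[a /f_surj[y <-] yE] | [y ->]].
      by exists y; apply: f_inj; rewrite -yE f_dif.
    by exists (f 1%N y); rewrite ?f_dif.
  + move=> i x x0; have [|a /f_surj[y <-] yE] := dgr_exact rA (f_gr i.+1 x).
      by rewrite -f_dif -[_ *m _]/(bd (x : fmod M i.+1)) x0 f0.
    by exists y; apply: f_inj; rewrite yE -f_dif.
- move=> i x j; have [u gu] := dgr_minimal rA (f_gr i.+1 x).
  have /fin_all_exists[y yE] l := f_surj _ _ (gu l).
  rewrite -f_dif; under eq_bigr do rewrite -yE.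
  rewrite -(linear_comb _ _ (f_lin i)) => /f_inj E.
  rewrite [bd x]E summxE raddf_sum big1 //= => l _.
  by rewrite mxE rmorphM /= mcoeffX mnm1_eq0 mul0r.
Qed.

Lemma resolution_embedding (F : gfcomplex k n) :
  resolves F (mono_ideal J) -> minimal F ->
  exists f : forall i, fmod F i -> A, graded_embedding f.
Proof.
move=> resF minF; have [M [f [[lf jf gf sf df] resM minM]]] := dg_resolution_gfcomplex.
have [B BP] := minimal_resolution_unique (monomial_graded_ideal k JM) resF resM minF minM.
exists (fun i x => f i (x *m B i)); split=> i.
- by move=> q x y; rewrite mulmxDl -scalemxAl lf.
- have [[C BC _] _] := BP i; move=> x y /jf /(congr1 (mulmx^~ C)).
  by rewrite -!mulmxA BC !mulmx1.
- by move=> x; apply: gf.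
- move=> a /sf[x <-]; have [[C _ CB] _] := BP i.
  by exists (x *m C); rewrite -mulmxA CB mulmx1.
- by move=> x; rewrite -df /bd -!mulmxA; have [_ ->] := BP i.
Qed.

(** The product is pulled back along [f], whose image is closed under products; every law is then
    checked after applying the injective [f]. *)
Lemma embedding_admits (F : gfcomplex k n) (f : forall i, fmod F i -> A) :
  graded_embedding f -> admits_scdg_algebra F.
Proof.
move=> [lf jf gf sf df].
have mul_ex i j l (ij : (i + j)%N = l) x y : exists z, f l z = f i x ** f j y.
  by apply: sf; rewrite -ij; apply: gr_mul.
pose mul : gmul F := fun i j l ij x y =>
  sval (constructive_indefinite_description _ (mul_ex i j l ij x y)).
have mulE i j l ij x y : f l (mul i j l ij x y) = f i x ** f j y.
  exact: svalP (constructive_indefinite_description _ (mul_ex i j l ij x y)).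
have [one oneE] := sf _ _ (gr_one gA).
have fZ i q x : f i (q *: x) = q *: f i x.
  by rewrite -[q *: x]addr0 lf (linear_at0 (lf i)) addr0.
have fD i x y : f i (x + y) = f i x + f i y.
  by rewrite -[x in LHS]scale1r lf scale1r.
exists mul, one; split; first split.
- by move=> i j l ij q x x' y; apply: jf; rewrite lf !mulE lf dg_mulDl dg_mulZl.
- by move=> i j l ij q x y y'; apply: jf; rewrite lf !mulE lf linearP.
- by move=> *; apply: jf; rewrite !mulE (dg_mulA lA).
- by move=> *; apply: jf; rewrite mulE oneE (dg_mul1l lA).
- by move=> *; apply: jf; rewrite mulE oneE (dg_mul1r lA).
- exists (fun x => dg_eps (f 0%N x)) => [q | x].
    by rewrite fZ oneE dg_eps_scalar.
  by apply: jf; rewrite fZ oneE -(dgr_scalarE rA (gf _ x)).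
- move=> i j l ij ij1 ij2 x y; apply: jf.
  rewrite df fD fZ !mulE !df (dg_difM lA) (gr_par gA (gf _ x)).
  by rewrite dg_mulZl.
- move=> j l ij ij' x y; apply: jf; rewrite df !mulE df (dg_difM lA).
  rewrite (gr_dif0 gA (gf _ x)) (gr_par gA (gf _ x)).
  by rewrite dg_mul0l add0r scale1r.
- move=> i l ij ij' x y; apply: jf; rewrite df !mulE df (dg_difM lA).
  by rewrite (gr_dif0 gA (gf _ y)) raddf0 addr0.
- split=> [i j l ij ji x y | i l ii x oi]; apply: jf.
    by rewrite fZ !mulE; apply: (gr_comm gA).
  rewrite mulE (gr_sq gA oi (gf _ x)).
  by rewrite -[0 in RHS](scale0r 0) fZ scale0r.
Qed.

End Transfer.

(** * Threshold graphs *)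

Section ThresholdGraphs.
Variables (k : fieldType) (V : finType).
Local Notation Q := {mpoly k[#|V|]}.
Implicit Types (S : {set V}) (E : rel V) (m : 'X_{1..#|V|}).

Definition vertex_mono S m := [exists u in S, 0 < m (enum_rank u)]%N.

(** For [u] and [v] distinct this is divisibility by the monomial of the edge. For a loop it would
    be weaker than divisibility by the square, whence the irreflexivity in [edge_ideal_mono]. *)
Definition edge_mono E m :=
  [exists u, exists v, [&& E u v, 0 < m (enum_rank u) & 0 < m (enum_rank v)]]%N.

Lemma vertex_mono_monomial S : monomial_ideal (vertex_mono S).
Proof.
move=> m m' /exists_inP[u uS mu]; apply/exists_inP; exists u => //.
by rewrite mnmDE addn_gt0 mu.
Qed.

Lemma edge_monoP E m :
  reflect (exists u v, [/\ E u v, 0 < m (enum_rank u) & 0 < m (enum_rank v)]%N)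
    (edge_mono E m).
Proof.
apply: (iffP existsP) => [[u /existsP[v /and3P[Euv mu mv]]] | [u [v [Euv mu mv]]]].
  by exists u, v.
by exists u; apply/existsP; exists v; apply/and3P.
Qed.

Lemma edge_mono_monomial E : monomial_ideal (edge_mono E).
Proof.
move=> m m' /edge_monoP[u [v [Euv mu mv]]]; apply/edge_monoP; exists u, v.
by rewrite !mnmDE !addn_gt0 mu mv.
Qed.

Lemma mnm_avoid (u v : V) m : u != v ->
  (U_(enum_rank v) + m)%MM (enum_rank u) = m (enum_rank u).
Proof. by move=> uv; rewrite mnmDE mnm1E (inj_eq enum_rank_inj) eq_sym (negPf uv). Qed.

Lemma vertex_mono_avoids S v : v \notin S -> avoids (enum_rank v) (vertex_mono S).
Proof.
move=> vS m /exists_inP[u uS]; rewrite mnm_avoid => [mu|].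
  by apply/exists_inP; exists u.
by apply: contraNneq vS => <-.
Qed.

Lemma threshold_build_sub S E : threshold_build S E ->
  forall x y, E x y -> x \in S /\ y \in S.
Proof.
elim=> // {}S {}E v _ _ IH x y; rewrite !inE.
  by move=> /IH[-> ->]; rewrite !orbT.
by case/or3P=> [/IH[-> ->]|/andP[-> ->]|/andP[-> ->]]; rewrite ?orbT.
Qed.

Lemma edge_mono_avoids S E v : threshold_build S E -> v \notin S ->
  avoids (enum_rank v) (edge_mono E).
Proof.
move=> bE vS m /edge_monoP[x [y [Exy]]]; have [xS yS] := threshold_build_sub bE Exy.
have neq u : u \in S -> u != v by move=> uS; apply: contraNneq vS => <-.
rewrite !mnm_avoid ?neq // => mx my.
by apply/edge_monoP; exists x, y.
Qed.

Lemma edge_ideal_mono E (p : Q) : irreflexive E ->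
  edge_ideal E p <-> mono_ideal (edge_mono E) p.
Proof.
move=> irrE; split=> [[c ->] | Jp].
  elim/big_ind: _ => [|? ?|u _]; [exact: mono_ideal0 | exact: mono_idealD |].
  elim/big_ind: _ => [|? ?|v Euv]; [exact: mono_ideal0 | exact: mono_idealD |].
  apply: mono_idealM; first exact: edge_mono_monomial.
  move=> m; rewrite -mpolyXD mcoeffX; case: (_ =P m) => [<- _|_]; last by rewrite eqxx.
  by apply/edge_monoP; exists u, v; rewrite !mnmDE !mnm1E !eqxx addn1.
rewrite [p]mpolyE big_seq; elim/big_ind: _ => [|q r [c ->] [d ->]|m].
- exists (fun _ _ => 0); rewrite big1 // => u _; rewrite big1 // => v _.
  by rewrite mul0r.
- exists (fun u v => c u v + d u v); rewrite -big_split; apply: eq_bigr => u _.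
  by rewrite -big_split; apply: eq_bigr => v _; rewrite mulrDl.
rewrite mcoeff_msupp => /Jp/edge_monoP[u [v [Euv mu mv]]].
have uv : u != v by apply: contraTneq Euv => ->; rewrite irrE.
pose m' := (m - (U_(enum_rank u) + U_(enum_rank v)))%MM.
(* One nonzero coefficient, on one orientation of the edge, produces the whole monomial. *)
exists (fun x y => if (x == u) && (y == v) then p@_m *: 'X_[m'] else 0).
rewrite (bigD1 u) //= [X in _ + X]big1 => [|x /negPf xu]; last first.
  by rewrite big1 // => y _; rewrite xu mul0r.
rewrite (bigD1 v) //= [X in _ + X + _]big1 => [|y /andP[_ /negPf yv]]; last first.
  by rewrite yv andbF mul0r.
rewrite !eqxx !addr0 -scalerAl -!mpolyXD submK //.
apply/mnm_lepP=> i; rewrite mnmDE !mnm1E.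
have [<-|_] := eqVneq (enum_rank u) i.
  by rewrite (inj_eq enum_rank_inj) eq_sym (negPf uv).
by have [<-|_] := eqVneq (enum_rank v) i.
Qed.

Lemma vertex_mono_setU1 S v m :
  vertex_mono (v |: S) m = vertex_mono S m || (0 < m (enum_rank v))%N.
Proof.
apply/exists_inP/orP => [[u] | [/exists_inP[u uS mu]|mv]].
- rewrite !inE => /orP[/eqP->|uS] mu; first by right.
  by left; apply/exists_inP; exists u.
- by exists u; rewrite // !inE uS orbT.
- by exists v; rewrite // !inE eqxx.
Qed.

(** The new edge ideal [I + 'X_v (S)] is the intersection of [(S)] and [I + ('X_v)], because [I] is
    contained in [(S)]. *)
Lemma edge_mono_dominating S E v m :
  (forall x y, E x y -> x \in S /\ y \in S) ->
  edge_mono (fun x y => [|| E x y, (x == v) && (y \in S) | (x \in S) && (y == v)]) m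
  = vertex_mono S m && (edge_mono E m || (0 < m (enum_rank v))%N).
Proof.
move=> ES; apply/edge_monoP/andP => [[x [y [+ mx my]]] | []].
  case/or3P=> [Exy|/andP[/eqP xv yS]|/andP[xS /eqP yv]].
  - have [xS _] := ES _ _ Exy; split; first by apply/exists_inP; exists x.
    by apply/orP; left; apply/edge_monoP; exists x, y.
  - by rewrite -xv mx orbT; split=> //; apply/exists_inP; exists y.
  - by rewrite -yv my orbT; split=> //; apply/exists_inP; exists x.
move=> /exists_inP[u uS mu] /orP[/edge_monoP[x [y [Exy mx my]]]|mv].
  by exists x, y; rewrite Exy.
by exists v, u; rewrite eqxx uS orbT.
Qed.

Lemma vertex_resolution (K : dga k #|V|) grK S v : v \notin S ->
  dg_resolution grK (vertex_mono S) ->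
  dg_resolution (adjoin_gr (A := K) grK (v := enum_rank v)) (vertex_mono (v |: S)).
Proof.
move=> vS /(adjoin_resolution (vertex_mono_avoids vS)).
by apply: eq_dg_resolution => m; rewrite vertex_mono_setU1.
Qed.

(** The polynomial ring on all of [V] is fixed during the induction; a vertex still to be added is a
    nonzerodivisor modulo both ideals. *)
Lemma threshold_resolution S E : threshold_build S E ->
  exists (A K : dga k #|V|) (grA : nat -> A -> Prop) (grK : nat -> K -> Prop)
    (phi : dga_map A K),
  [/\ dg_resolution grA (edge_mono E), dg_resolution grK (vertex_mono S)
    & graded_minimal_map grA grK phi].
Proof.
elim=> {S E} [|S E v vS bE|S E v vS bE].
- have lid : dga_map_laws (id : base_dga k #|V| -> base_dga k #|V|) by split.
  exists (base_dga k #|V|), (base_dga k #|V|), (@base_gr _ _), (@base_gr _ _), (DGAMap lid).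
  split.
  + apply: eq_dg_resolution (base_resolution _ _) => m.
    by apply/esym/edge_monoP => -[? [? []]].
  + apply: eq_dg_resolution (base_resolution _ _) => m.
    by apply/esym/exists_inP => -[u]; rewrite inE.
  + split=> // i a /= ->; exists (fun=> 0) => //.
    by rewrite big1 // => j _; rewrite scaler0.
- move=> [A [K [grA [grK [phi [rA rK phiP]]]]]].
  exists A, (adjoin K (enum_rank v)), grA, (adjoin_gr grK (v := enum_rank v)),
    (DGAMap (adjoin_map_laws phi (enum_rank v))).
  split=> //; first exact: vertex_resolution.
  exact: adjoin_map_minimal (dgr_grading rK) phiP.
- move=> [A [K [grA [grK [phi [rA rK phiP]]]]]].
  exists (fiber A K (enum_rank v)), (adjoin K (enum_rank v)),
    (fiber_gr phi (v := enum_rank v) grA grK),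
    (adjoin_gr grK (v := enum_rank v)), (DGAMap (fiber_map_laws phi (enum_rank v))).
  have ES := threshold_build_sub bE.
  split; [|exact: vertex_resolution|exact: fiber_map_minimal rA rK phiP].
  apply: eq_dg_resolution (fiber_resolution rA rK phiP _ _ _ _) => [m|m||m|m].
  + by rewrite edge_mono_dominating.
  + move=> /edge_monoP[x [y [/ES[xS _] mx _]]].
    by apply/exists_inP; exists x.
  + exact: vertex_mono_monomial.
  + exact: edge_mono_avoids bE vS m.
  + exact: vertex_mono_avoids vS m.
Qed.

End ThresholdGraphs.

Theorem corollary4p25 (k : fieldType) (V : finType) (E : rel V)
    (thrE : threshold E) (F : gfcomplex k #|V|)
    (resF : resolves F (edge_ideal E)) (minF : minimal F) :
  admits_scdg_algebra F.
Proof.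
have [_ irrE] := threshold_simple thrE; case: thrE => E' bE' eqE.
(* The construction yields a relation [E'] that agrees with [E] only pointwise, so the ideals are
   compared first. *)
have edge_ideal_E' (p : {mpoly k[#|V|]}) :
    edge_ideal E p <-> mono_ideal (edge_mono E') p.
  apply: iff_trans (edge_ideal_mono _ irrE) _.
  have eqJ m : edge_mono E m = edge_mono E' m.
    by apply: eq_existsb => u; apply: eq_existsb => v; rewrite eqE.
  by split=> h m /h; rewrite eqJ.
have [A [_ [gr [_ [_ [rA _ _]]]]]] := threshold_resolution k bE'.
have {}resF : resolves F (mono_ideal (edge_mono E')).
  have [aug [haug surj ex0 ex]] := resF; exists aug; split=> // [q | x].
    by have [x /edge_ideal_E' Ix] := surj q; exists x.
  exact: iff_trans (iff_sym (edge_ideal_E' _)) (ex0 x).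
have [f fP] := resolution_embedding rA (@edge_mono_monomial V E') resF minF.
exact: (embedding_admits rA fP).
Qed.
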